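(* Every torsion GGS group has the subgroup induction property.
   Context: Let $p$ be an odd prime and let $T$ be the $p$-regular rooted tree, whose vertices are identified with the words in $\{1,\dots,p\}^*$; the root is the empty word, the children of $v$ are $v1,\dots,vp$, and $\mathcal L_n$ is the set of words of length $n$. $\operatorname{Aut}(T)$ is the group of automorphisms of $T$ (fixing the root). For $g\in\operatorname{Aut}(T)$ and a vertex $v$, the section $\varphi_v(g)\in\operatorname{Aut}(T)$ is the unique automorphism with $g\cdot(vw)=(g\cdot v)(\varphi_v(g)\cdot w)$ for all $w\in T$. For $G\leq\operatorname{Aut}(T)$, $\operatorname{Stab}_G(\mathcal L_1)$ is the pointwise stabilizer of $\mathcal L_1$ in $G$. $G$ is self-similar if $\varphi_v(G)\leq G$ for all vertices $v$. GGS groups: let $\mathbf e=(e_0,\dots,e_{p-2})\in(\mathbf F_p)^{p-1}\setminus\{0\}$. The GGS group with defining vector $\mathbf e$ is $G_{\mathbf e}=\langle a,b\rangle\leq\operatorname{Aut}(T)$, where $a$ permutes the vertices of $\mathcal L_1$ by the cyclic permutation $(1\,2\,\dots\,p)$ and has trivial sections at all vertices of $\mathcal L_1$, and $b=(a^{e_0},\dots,a^{e_{p-2}},b)$, i.e. $b$ fixes $\mathcal L_1$ pointwise, has section $a^{e_{i-1}}$ at the vertex $i$ for $1\leq i\leq p-1$, and has section $b$ at the vertex $p$. A GGS group is any such group, for any odd prime $p$ and any such $\mathbf e$; it is self-similar. Let $G$ be self-similar. A class $\mathcal X$ of subgroups of $G$ is inductive if: (A) $\{1\}\in\mathcal X$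 and $G\in\mathcal X$; (B) if $H\leq L$ are subgroups of $G$ with $[L:H]$ finite and $H\in\mathcal X$, then $L\in\mathcal X$; (C) if $H$ is a finitely generated subgroup of $\operatorname{Stab}_G(\mathcal L_1)$ and $\varphi_v(H)\in\mathcal X$ for all $v\in\mathcal L_1$, then $H\in\mathcal X$. $G$ has the subgroup induction property if every inductive class of subgroups of $G$ contains every finitely generated subgroup of $G$. *)

(* Defs.v *)
From HB Require Import structures.
From mathcomp Require Import all_boot all_algebra.
From mathcomp Require Import boolp classical_sets functions cardinality.

Set Implicit Arguments.
Unset Strict Implicit.
Unset Printing Implicit Defensive.

Local Open Scope classical_set_scope.
Local Open Scope group_scope.

(* Letters are numbered from 0: the letter i of {1, ..., p} is the ordinal
   i - 1 of 'I_p. *)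
Definition vertex (p : nat) : Type := seq 'I_p.

Definition level (p n : nat) : set (vertex p) := [set v | size v = n].

Definition adjacent (p : nat) (u v : vertex p) : Prop :=
  exists x : 'I_p, v = rcons u x \/ u = rcons v x.

Record tree_aut (p : nat) := TreeAut {
  aut_fun :> vertex p -> vertex p;
  aut_inv : vertex p -> vertex p;
  aut_funK : cancel aut_fun aut_inv;
  aut_invK : cancel aut_inv aut_fun;
  aut_root : aut_fun [::] = [::];
  aut_adj : forall u v, adjacent (aut_fun u) (aut_fun v) <-> adjacent u v
}.

Lemma tree_aut_ext (p : nat) (g h : tree_aut p) : g =1 h -> g = h.
Proof.
case: g h => [f f' fK f'K f0 fa] [k k' kK k'K k0 ka] /= fk.
have {}fk : f = k by apply/funext.
subst k.
have fk' : f' = k' by apply/funext => v; rewrite -{1}(k'K v) fK.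
subst k'; congr TreeAut; exact: Prop_irrelevance.
Qed.

Local Obligation Tactic := idtac.

Section TreeAutGroup.
Variable p : nat.
Implicit Types (g h : tree_aut p) (u v w : vertex p).

Definition aut1 : tree_aut p :=
  @TreeAut p id id (fun=> erefl) (fun=> erefl) erefl
    (fun u v => iff_refl (adjacent u v)).

Program Definition autV g : tree_aut p :=
  @TreeAut p (aut_inv g) g (aut_invK g) (aut_funK g) _ _.
Next Obligation. by move=> g; rewrite -{1}(aut_root g) aut_funK. Qed.
Next Obligation. by move=> g u v; rewrite -(aut_adj g) !aut_invK. Qed.

Program Definition autM g h : tree_aut p :=
  @TreeAut p (g \o h) (aut_inv h \o aut_inv g)
    (can_comp (aut_funK g) (aut_funK h)) (can_comp (aut_invK h) (aut_invK g)) _ _.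
Next Obligation. by move=> g h /=; rewrite !aut_root. Qed.
Next Obligation. by move=> g h u v /=; rewrite !aut_adj. Qed.

Fact autMA : associative autM.
Proof. by move=> f g h; apply: tree_aut_ext. Qed.
Fact aut1M : left_id aut1 autM.
Proof. by move=> g; apply: tree_aut_ext. Qed.
Fact autM1 : right_id aut1 autM.
Proof. by move=> g; apply: tree_aut_ext. Qed.
Fact autVM : left_inverse aut1 autV autM.
Proof. by move=> g; apply: tree_aut_ext => v /=; rewrite aut_funK. Qed.
Fact autMV : right_inverse aut1 autV autM.
Proof. by move=> g; apply: tree_aut_ext => v /=; rewrite aut_invK. Qed.

HB.instance Definition _ := gen_eqMixin (tree_aut p).
HB.instance Definition _ := gen_choiceMixin (tree_aut p).
HB.instance Definition _ :=
  isGroup.Build (tree_aut p) autMA aut1M autM1 autVM autMV.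

Lemma autME g h v : (g * h) v = g (h v).
Proof. by []. Qed.

Lemma aut_rcons g v (x : 'I_p) :
  size (g v) = size v /\ exists y, g (rcons v x) = rcons (g v) y.
Proof.
elim/last_ind: v x => [|v z IHv] x.
  split; first by rewrite aut_root.
  have /(aut_adj g) : adjacent [::] (rcons [::] x) by exists x; left.
  by case=> y []; rewrite aut_root; [exists y | case: (g _)].
have [sv [y gvz]] := IHv z; split; first by rewrite gvz !size_rcons sv.
have /(aut_adj g) : adjacent (rcons v z) (rcons (rcons v z) x).
  by exists x; left.
case=> t [->|]; first by exists t.
rewrite gvz => /rcons_inj[gv _].
have /(congr1 size) : v = rcons (rcons v z) x.
  by rewrite -[LHS](aut_funK g) gv aut_funK.
by rewrite !size_rcons => /eqP; rewrite -addn2 -{1}[size v]addn0 eqn_add2l.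
Qed.

Lemma size_aut g v : size (g v) = size v.
Proof.
case/lastP: v => [|v x]; first by rewrite aut_root.
by have [sv [y ->]] := aut_rcons g v x; rewrite !size_rcons sv.
Qed.

Lemma aut_cat g v w : g (v ++ w) = g v ++ drop (size v) (g (v ++ w)).
Proof.
elim/last_ind: w => [|w x IHw]; first by rewrite cats0 drop_oversize ?cats0 ?size_aut.
have [_ [y]] := aut_rcons g (v ++ w) x.
rewrite -rcons_cat => ->; rewrite {1}IHw -cats1 -cats1 drop_cat size_aut size_cat.
case: ltnP => [_|]; first by rewrite -catA.
rewrite -{2}[size v]addn0 leq_add2l leqn0 => /nilP->.
by rewrite cats0 addn0 subnn drop0 drop_oversize ?size_aut ?cats0.
Qed.

(* The unique h with g (v ++ w) = g v ++ h w for all w, see aut_sectionP *)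
Definition section_fun g v w : vertex p := drop (size v) (g (v ++ w)).

Lemma section_funE g v w : g (v ++ w) = g v ++ section_fun g v w.
Proof. exact: aut_cat. Qed.

Lemma adjacent_cat u v w : adjacent (u ++ v) (u ++ w) <-> adjacent v w.
Proof.
split=> -[x xP]; exists x; last by rewrite !rcons_cat; case: xP => ->; auto.
by move: xP; rewrite !rcons_cat => -[/eqP|/eqP];
  rewrite eqseq_cat // eqxx => /eqP; auto.
Qed.

Fact section_funK g v :
  cancel (section_fun g v) (section_fun g^-1 (g v)).
Proof.
move=> w; rewrite {1}/section_fun -section_funE size_aut.
by rewrite [g^-1 _]aut_funK drop_size_cat.
Qed.

Program Definition aut_section v g : tree_aut p :=
  @TreeAut p (section_fun g v) (section_fun g^-1 (g v)) (section_funK g v) _ _ _.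
Next Obligation.
move=> v g w; have := section_funK g^-1 (g v) w.
by rewrite invgK [g^-1 (g v)]aut_funK.
Qed.
Next Obligation.
by move=> v g; rewrite /section_fun cats0 drop_oversize ?size_aut.
Qed.
Next Obligation.
by move=> v g u w; rewrite -(adjacent_cat (g v)) -!section_funE aut_adj adjacent_cat.
Qed.

Lemma aut_sectionP g v h :
  (forall w, g (v ++ w) = g v ++ h w) <-> h = aut_section v g.
Proof.
split=> [gvh|-> w]; last exact: section_funE.
by apply: tree_aut_ext => w; rewrite /= /section_fun gvh drop_size_cat ?size_aut.
Qed.

End TreeAutGroup.

Section LetterwiseAut.
Variables (p : nat) (f f' : vertex p -> vertex p).
Hypotheses (fK : cancel f f') (f'K : cancel f' f).
Hypotheses (f0 : f [::] = [::]) (f'0 : f' [::] = [::]).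
Hypothesis f_rcons : forall u x, exists y, f (rcons u x) = rcons (f u) y.

Fact mk_aut_adj u v : adjacent (f u) (f v) <-> adjacent u v.
Proof.
have f_child w z t : f w = rcons (f z) t -> exists x, w = rcons z x.
  case/lastP: w => [|w x]; first by rewrite f0; case: (f z).
  have [y ->] := f_rcons w x => /rcons_inj[/(can_inj fK)-> _].
  by exists x.
split=> -[x [] E].
- by have [y] := f_child _ _ _ E; exists y; left.
- by have [y] := f_child _ _ _ E; exists y; right.
- by have [y Ey] := f_rcons u x; exists y; left; rewrite E.
- by have [y Ey] := f_rcons v x; exists y; right; rewrite E.
Qed.

Definition mk_aut : tree_aut p := TreeAut fK f'K f0 mk_aut_adj.

End LetterwiseAut.

Section Generators.
Variable p : nat.

Definition map_head (s : 'I_p -> 'I_p) (v : vertex p) : vertex p :=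
  if v is x :: w then s x :: w else [::].

Fact map_headK s s' : cancel s s' -> cancel (map_head s) (map_head s').
Proof. by move=> sK [|x w] //=; rewrite sK. Qed.

Fact map_head_rcons s u x :
  exists y, map_head s (rcons u x) = rcons (map_head s u) y.
Proof. by case: u => [|z u] /=; [exists (s x) | exists x]. Qed.

(* ordS is the cyclic successor of 'I_p *)
Definition ggs_a : tree_aut p :=
  mk_aut (map_headK (@ordSK p)) (map_headK (@ord_predK p))
    erefl (map_head_rcons (@ordS p)).

Variable e : 'rV['F_p]_p.-1.

(* Exponents in 'F_p are replaced with their representatives in nat; the
   sections of b at the first p - 1 letters are the a ^+ e 0 i, and b itself
   at the last one. *)
Fixpoint ggs_b_fun (v : vertex p) : vertex p :=
  if v is x :: w then
    x :: (if insub (x : nat) is Some i then (ggs_a ^+ (e ord0 i : nat)) w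
          else ggs_b_fun w)
  else [::].

Fixpoint ggs_b_inv (v : vertex p) : vertex p :=
  if v is x :: w then
    x :: (if insub (x : nat) is Some i then (ggs_a ^- (e ord0 i : nat)) w
          else ggs_b_inv w)
  else [::].

Fact ggs_b_funK : cancel ggs_b_fun ggs_b_inv.
Proof.
elim=> //= x w IHw; congr cons; case: insubP => [i _ _|_]; last exact: IHw.
exact: aut_funK.
Qed.

Fact ggs_b_invK : cancel ggs_b_inv ggs_b_fun.
Proof.
elim=> //= x w IHw; congr cons; case: insubP => [i _ _|_]; last exact: IHw.
exact: aut_invK.
Qed.

Fact ggs_b_rcons u x :
  exists y, ggs_b_fun (rcons u x) = rcons (ggs_b_fun u) y.
Proof.
elim: u => [|z u [y IHu]] /=.
  by exists x; case: insubP => [i _ _|_] //=; rewrite aut_root.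
case: insubP => [i _ _|_]; last by exists y; rewrite IHu.
by have [_ [t ->]] := aut_rcons (ggs_a ^+ (e ord0 i : nat)) u x; exists t.
Qed.

Definition ggs_b : tree_aut p :=
  mk_aut ggs_b_funK ggs_b_invK erefl ggs_b_rcons.

End Generators.

Section Subgroups.
Variable gT : groupType.
Implicit Types (S H L G : set gT).

Definition subgroup H : Prop := group_closed [in H].

Definition generated S : set gT := smallest subgroup S.

Definition finitely_generated H : Prop :=
  exists2 S : set gT, finite_set S & H = generated S.

Definition finite_index H L : Prop :=
  finite_set [set [set x * h | h in H] | x in L].

Definition torsion G : Prop :=
  forall g, G g -> exists2 n : nat, (0 < n)%N & g ^+ n = 1.

End Subgroups.

Definition GGS (p : nat) (e : 'rV['F_p]_p.-1) : set (tree_aut p) :=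
  generated [set ggs_a p; ggs_b e].

Section SubgroupInduction.
Variable p : nat.
Implicit Types (G H L : set (tree_aut p)).

Definition stab_level1 G : set (tree_aut p) :=
  [set g | G g /\ forall v, level 1 v -> g v = v].

Definition section_image (v : vertex p) H : set (tree_aut p) :=
  [set aut_section v h | h in H].

Definition self_similar G : Prop :=
  subgroup G /\ forall v, section_image v G `<=` G.

Record inductive_class G (X : set (set (tree_aut p))) : Prop := {
  inductive_sub : forall H, X H -> subgroup H /\ H `<=` G;
  inductive_triv : X [set 1];
  inductive_full : X G;
  inductive_finite_index : forall H L,
    subgroup H -> subgroup L -> H `<=` L -> L `<=` G ->
    finite_index H L -> X H -> X L;
  inductive_sections : forall H,
    subgroup H -> H `<=` stab_level1 G -> finitely_generated H ->
    (forall v, level 1 v -> X (section_image v H)) -> X H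
}.

Definition subgroup_induction_property G : Prop :=
  self_similar G /\
  forall X, inductive_class G X ->
  forall H, subgroup H -> H `<=` G -> finitely_generated H -> X H.

End SubgroupInduction.

(* Main.v *)
From HB Require Import structures.
Require Import Defs.
From mathcomp Require Import all_boot all_algebra finfield.
From mathcomp Require Import boolp classical_sets functions cardinality.
From mathcomp Require Import ring zify.

(** Write G for the group and call a maximal power of b in a word a syllable.
    The argument is an induction on the number of syllables needed to generate
    a subgroup, with one obstruction: subgroups that map onto the
    abelianization of G.  These are shown to be in the class by a separate
    descent, modelled on Pervova's proof that a proper subgroup of G never
    maps onto the abelianization.

    Letters are given coordinates in F_p in which a is z -> z + 1 and the
    letter carrying b is 0; E z is the exponent of the section of b at z, with
    E 0 = 0.  Two homomorphisms G -> F_p are used: the rotation [turn] on the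
    first level and the exponent sum [bdeg] of b.  For g in G the vector A of
    the turns of its sections and the vector B of their b-degrees satisfy A =
    E * B (convolution over Z/p, [turn_sec]), and B sums to the b-degree of g
    ([sum_bdeg_sec]).  The algebra F_p[Z/p] is local, with maximal ideal the
    elements of sum zero.  If the sum s of E is not zero, an element with
    nonzero turn t and nonzero b-degree d yields, by taking a section of its
    p-th power, an element with turn s d and b-degree d, whose order is
    smaller; so torsion forces s = 0 ([torsion_sum_exponent]).  Then E is
    nilpotent and B = j E * B implies B = 0: the pairs (A z, B z) span the
    plane as soon as A is nonzero.  Hence, if H contains an element h of
    nonzero turn, the sections of H, which are conjugate under powers of h,
    either all stabilise the first level or all map onto the abelianization
    ([secgrp_stab_or_onto]).  If H is moreover onto, it contains an element of
    turn 0 and nonzero b-degree; its vector B is invertible, A = E * B is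
    nonzero, and all sections of H are onto ([onto_secgrp]).

    An element with n syllables has sections with at most ceil(n/2) syllables,
    whose total number of syllables is at most n ([syl_sec], [syl_weights]).

    Subgroups that are onto ([conjugates_in_onto]): from an element of turn 0
    and nonzero b-degree, sections, or sections of the p-th power of a
    section, give a shorter such element in a section of the subgroup, until
    it is a conjugate of a power of b.  Up to conjugation b is then in the
    subgroup and in its section at 0, and a second descent shortens t in a
    conjugate of a by t lying in the subgroup; it ends with a and b in the
    subgroup, which is then G.

    Subgroups L of the stabiliser of the first level generated by elements
    with at most n syllables ([conjugates_in_stab]), by induction on n.  A
    section K of L is generated by elements with at most m = ceil(n/2)
    syllables.  If K is in the stabiliser, induction applies.  Otherwise some
    generator h of K moves the first level, the Schreier generators obtained
    by going round the cycle of h in the shorter direction show that the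
    sections of K are generated by elements with at most 2 floor(m/2) +
    ceil(m/2) syllables, and these sections are onto or in the stabiliser.
    This bound is smaller than n for n >= 2 except when n = 3, where the
    precise form of the generators is used ([conjugates_in_three]).  For n <=
    1 the sections of L are finite or G. *)

Import GRing.Theory.

Set Implicit Arguments.
Unset Strict Implicit.
Unset Printing Implicit Defensive.

Local Open Scope classical_set_scope.
Local Open Scope group_scope.

(** * Subgroups and generating sets *)

Section SubgroupBasics.
Variable gT : groupType.
Implicit Types (H L S : set gT) (x y g : gT).

Lemma subgroup_intro H :
  H 1 -> (forall x y, H x -> H y -> H (x * y)) ->
  (forall x, H x -> H x^-1) -> subgroup H.
Proof.
move=> H1 HM HV; split=> [|x y]; first exact/mem_set.
by move=> /set_mem Hx /set_mem Hy; apply/mem_set/HM => //; apply: HV.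
Qed.

Lemma subgroup1 H : subgroup H -> H 1.
Proof. by case=> /set_mem. Qed.

Lemma subgroupM H x y : subgroup H -> H x -> H y -> H (x * y).
Proof.
by move=> /group_closedM HM Hx Hy; apply/set_mem/HM; apply/mem_set.
Qed.

Lemma subgroupV H x : subgroup H -> H x -> H x^-1.
Proof. by move=> /group_closedV HV Hx; apply/set_mem/HV/mem_set. Qed.

Lemma subgroupX H x n : subgroup H -> H x -> H (x ^+ n).
Proof.
move=> gH Hx; elim: n => [|n IHn]; first by rewrite expg0; apply: subgroup1.
by rewrite expgS; apply: subgroupM.
Qed.

Lemma subgroupJ H x y : subgroup H -> H x -> H y -> H (x ^ y).
Proof.
by move=> gH Hx Hy; rewrite conjgE; do !apply: subgroupM => //;
  apply: subgroupV.
Qed.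

Lemma subgroup_generated S : subgroup (generated S).
Proof.
apply: subgroup_intro => [H|x y Sx Sy H|x Sx H] [gH SH].
- exact: subgroup1.
- by apply: subgroupM => //; [apply: Sx | apply: Sy].
- by apply: subgroupV => //; apply: Sx.
Qed.

Lemma sub_generated S : S `<=` generated S.
Proof. exact: sub_gen_smallest. Qed.

Lemma generated_min S H : subgroup H -> S `<=` H -> generated S `<=` H.
Proof. by move=> gH SH; apply: smallest_sub. Qed.

Lemma subgroup_trivial : subgroup [set (1 : gT)].
Proof.
apply: subgroup_intro => [//|x y -> ->|x ->]; first by rewrite mulg1.
by rewrite invg1.
Qed.

Lemma subgroup_conj H g : subgroup H -> subgroup [set x ^ g | x in H].
Proof.
move=> gH; apply: subgroup_intro => [|_ _ [x Hx <-] [y Hy <-]|_ [x Hx <-]].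
- by exists 1; [apply: subgroup1 | rewrite conj1g].
- by exists (x * y); [apply: subgroupM | rewrite conjMg].
- by exists x^-1; [apply: subgroupV | rewrite conjVg].
Qed.

Lemma conj_setM H g h :
  [set x ^ h | x in [set x ^ g | x in H]] = [set x ^ (g * h) | x in H].
Proof.
apply/seteqP; split=> [_ [_ [x Hx <-] <-]|_ [x Hx <-]].
  by exists x; rewrite ?conjgM.
by exists (x ^ g); [exists x | rewrite conjgM].
Qed.

Lemma conj_set1 H : [set x ^ 1 | x in H] = H.
Proof.
apply/seteqP; split=> [_ [x Hx <-]|x Hx]; first by rewrite conjg1.
by exists x; rewrite ?conjg1.
Qed.

Lemma conj_sub H L g :
  subgroup L -> L g -> H `<=` L -> [set x ^ g | x in H] `<=` L.
Proof. by move=> gL Lg HL _ [x Hx <-]; apply: subgroupJ => //; apply: HL. Qed.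

Lemma conj_set_id H g : subgroup H -> H g -> [set x ^ g | x in H] = H.
Proof.
move=> gH Hg; apply/seteqP; split; first exact: conj_sub.
move=> x Hx; exists (x ^ g^-1); last by rewrite conjgKV.
by apply: subgroupJ => //; apply: subgroupV.
Qed.

End SubgroupBasics.

Lemma generated_image (gT rT : groupType) (S : set gT) (f : gT -> rT) :
  (forall x y, generated S x -> generated S y -> f (x * y) = f x * f y) ->
  [set f x | x in generated S] = generated [set f x | x in S].
Proof.
have gS := subgroup_generated S; move=> fM.
have f1 : f 1 = 1.
  apply: (mulgI (f 1)); rewrite -fM ?mulg1 //; exact: subgroup1.
have fV x : generated S x -> f x^-1 = (f x)^-1.
  move=> Sx; apply: (mulgI (f x)); rewrite -fM ?mulgV ?f1 //;
    exact: (subgroupV gS).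
apply/seteqP; split.
  move=> _ [x Sx <-].
  suff /(_ x Sx)[] : generated S `<=`
      [set x | generated S x /\ generated [set f x | x in S] (f x)] by [].
  apply: generated_min => {x Sx} [|x Sx]; last first.
    by split; apply: sub_generated => //=; exists x.
  have gfS := subgroup_generated [set f x | x in S].
  apply: subgroup_intro => /= [|x y [Sx fx] [Sy fy]|x [Sx fx]].
  - by rewrite f1; split; apply: subgroup1.
  - by rewrite fM //; split; [apply: (subgroupM gS)|apply: (subgroupM gfS)].
  - by rewrite fV //; split; [apply: (subgroupV gS)|apply: (subgroupV gfS)].
apply: generated_min; last by move=> _ [x Sx <-]; exists x => //;
  apply: sub_generated.
apply: subgroup_intro => [|_ _ [x Sx <-] [y Sy <-]|_ [x Sx <-]].
- by exists 1; [apply: subgroup1 | ].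
- by exists (x * y); [apply: (subgroupM gS) | rewrite fM].
- by exists x^-1; [apply: (subgroupV gS) | rewrite fV].
Qed.

Lemma finitely_generated_image (gT rT : groupType) (H : set gT) (f : gT -> rT) :
  (forall x y, H x -> H y -> f (x * y) = f x * f y) ->
  finitely_generated H -> finitely_generated [set f x | x in H].
Proof.
move=> fM [S finS defH]; exists [set f x | x in S]; first exact: finite_image.
by rewrite defH generated_image // -defH.
Qed.

(** * Functions on F_p and their convolution *)

Section Convolution.
Local Open Scope ring_scope.
Variable p : nat.
Hypothesis pr_p : prime p.
Let F := 'F_p.
Implicit Types (f c q E : F -> F) (z t w : F).

Lemma big_shift (R : Type) (idx : R) (op : Monoid.com_law idx) (f : F -> R) t :
  \big[op/idx]_z f (z + t) = \big[op/idx]_z f z.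
Proof. by rewrite [RHS](reindex_inj (addIr t)). Qed.

Lemma sum_shift f t : \sum_z f (z + t) = \sum_z f z.
Proof. exact: big_shift. Qed.

Lemma Fp_expp1 z : z != 0 -> z ^+ p.-1 = 1.
Proof.
move=> z0; apply: (mulfI z0); rewrite -exprS mulr1.
have := expf_card z; rewrite card_Fp //.
by rewrite prednK // prime_gt0.
Qed.

(** Every function on F_p is a polynomial, so some moment of f is nonzero.
    For the least such r, the powers (z + t)^r and z^r differ by lower powers,
    on which f vanishes.  In the local algebra F_p[Z/p] this functional reads
    off the leading coefficient of f in powers of the uniformizer. *)
Lemma invariant_functional f : (exists z, f z != 0) ->
  exists q, \sum_z q z * f z = 1 /\
            forall t, \sum_z q (z + t) * f z = 1.
Proof.
case=> z0 fz0.
pose mom r := \sum_z z ^+ r * f z.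
have shift_mom r t : \sum_z (z + t) ^+ r * f z =
    \sum_(i < r.+1) (t ^+ i *+ 'C(r, i)) * mom (r - i)%N.
  under eq_bigr => z _ do rewrite exprDn mulr_suml.
  rewrite exchange_big; apply: eq_bigr => i _; rewrite mulr_sumr.
  by apply: eq_bigr => z _; rewrite !mulrnAl mulrA [t ^+ i * _]mulrC.
have ex_mom : exists r, mom r != 0.
  apply: contrapT => /forallNP mom0; case/negP: fz0; apply/eqP.
  have {}mom0 r : mom r = 0 by apply/eqP; apply: contra_notT (mom0 r).
  (* The function 1 - (z - z0)^(p - 1) is the indicator of z0. *)
  have -> : f z0 = \sum_z (z - z0) ^+ 0 * f z - \sum_z (z - z0) ^+ p.-1 * f z.
    rewrite -sumrB (bigD1 z0) //= big1 => [|z zz0].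
      rewrite subrr expr0 expr0n.
      have /negPf-> : p.-1 != 0%N by have := prime_gt1 pr_p; case: (p) => [|[]].
      by rewrite mul1r mul0r subr0 addr0.
    by rewrite Fp_expp1 ?subr_eq0 // expr0 subrr.
  rewrite !shift_mom !big1 ?subr0 // => i _; by rewrite mom0 mulr0.
case: (ex_minnP ex_mom) => r mr r_min.
exists (fun z => z ^+ r / mom r).
have lin t : \sum_z ((z + t) ^+ r / mom r) * f z = 1.
  have -> : \sum_z ((z + t) ^+ r / mom r) * f z =
            (\sum_z (z + t) ^+ r * f z) / mom r.
    by rewrite mulr_suml; apply: eq_bigr => z _; rewrite mulrAC.
  rewrite shift_mom big_ord_recl /= expr0 bin0 mulr1n mul1r subn0.
  rewrite big1 ?addr0 ?divff // => i _; case: (eqVneq (mom (r - bump 0 i)%N) 0).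
    by move->; rewrite mulr0.
  move=> /r_min; rewrite /bump /= add1n leqNgt; case: i => i /= ilt.
  by rewrite ltn_subrL /=; case: (r) ilt.
split=> // ; rewrite -[RHS](lin 0); apply: eq_bigr => z _; by rewrite addr0.
Qed.

(** The product of F_p[Z/p]. *)
Definition conv E c w := \sum_i c i * E (w - i).

(** An element of F_p[Z/p] with nonzero sum is a unit. *)
Lemma conv_neq0 E c :
  (exists z, E z != 0) -> \sum_z c z != 0 -> exists z, conv E c z != 0.
Proof.
move=> /invariant_functional[q [_ qE]] c0.
apply: contrapT => /forallNP conv0; case/negP: c0; apply/eqP.
have {}conv0 z : conv E c z = 0 by apply/eqP; apply: contra_notT (conv0 z).
transitivity (\sum_w q w * conv E c w); last first.
  by rewrite big1 // => w _; rewrite conv0 mulr0.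
under [RHS]eq_bigr => w _ do rewrite mulr_sumr.
rewrite exchange_big /=; apply: eq_bigr => i _.
rewrite -[LHS]mulr1 -(qE i) mulr_sumr -[RHS](sum_shift _ i).
by apply: eq_bigr => w _; rewrite addrK mulrCA.
Qed.

(** An element E of F_p[Z/p] with sum zero is nilpotent, so 1 - j E is a unit.
    The invariant functional of c sees this directly: applied to E * c it
    factors through the sum of E. *)
Lemma conv_eigen E c j : \sum_z E z = 0 ->
  (forall z, c z = j * conv E c z) -> forall z, c z = 0.
Proof.
move=> sumE c_eig z; apply/eqP; apply: contrapT => /negP cz.
have /invariant_functional[q [q1 qc]] : exists z, c z != 0 by exists z.
have /eqP := oner_neq0 F; apply; rewrite -q1.
suff conv0 : \sum_w q w * conv E c w = 0.
  under eq_bigr => w _ do rewrite c_eig mulrCA.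
  by rewrite -mulr_sumr conv0 mulr0.
under eq_bigr => w _.
  rewrite /conv (reindex_inj (inj_comp (addrI w) oppr_inj)) /= mulr_sumr.
  under eq_bigr => i _ do rewrite opprB addrCA subrr addr0.
  over.
rewrite exchange_big /= -[RHS]sumE; apply: eq_bigr => u _.
rewrite -[RHS]mul1r -(qc u) mulr_suml -(sum_shift _ u) .
by apply: eq_bigr => w _; rewrite addrK mulrA.
Qed.

End Convolution.

(** * Powers with exponents in F_p *)

Section FpPowers.
Variables (p : nat) (gT : groupType).
Hypothesis pr_p : prime p.
Implicit Types (g h : gT) (x y z : 'F_p).

Lemma ltn_Fp x : (x < p)%N.
Proof. by apply: leq_trans (ltn_ord x) _; rewrite Fp_cast. Qed.

Definition fpow g x := g ^+ (x : nat).

Lemma expg_modn g m : g ^+ p = 1 -> g ^+ (m %% p) = g ^+ m.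
Proof.
by move=> gp; rewrite {2}(divn_eq m p) expgnDr mulnC expgnA gp expg1n mul1g.
Qed.

Lemma fpow_nat g n : g ^+ p = 1 -> fpow g n%:R%R = g ^+ n.
Proof. by move=> gp; rewrite /fpow val_Fp_nat // expg_modn. Qed.

Lemma fpowD g x y : g ^+ p = 1 -> fpow g (x + y)%R = fpow g x * fpow g y.
Proof.
move=> gp; rewrite -(natr_Zp x) -(natr_Zp y) -natrD !fpow_nat //.
by rewrite expgnDr.
Qed.

Lemma fpow0 g : fpow g 0%R = 1.
Proof. by rewrite /fpow expg0. Qed.

Lemma fpowN g x : g ^+ p = 1 -> fpow g (- x)%R = (fpow g x)^-1.
Proof.
by move=> gp; apply: (mulgI (fpow g x)); rewrite -fpowD // subrr mulgV fpow0.
Qed.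

Lemma fpow_conj g x y : g ^+ p = 1 -> fpow g x ^ fpow g y = fpow g x.
Proof. by move=> gp; rewrite conjgE -fpowN // -!fpowD // addrC addrK. Qed.

Lemma fpow1 g : fpow g 1%R = g.
Proof. by rewrite /fpow Fp_Zcast //= expg1. Qed.

Lemma fpowX g x n : g ^+ p = 1 -> fpow g x ^+ n = fpow g (x * n%:R)%R.
Proof.
move=> gp; rewrite -{2}(natr_Zp x) -natrM fpow_nat //.
by rewrite /fpow expgnA.
Qed.

Lemma subgroup_fpow (H : set gT) g x y : g ^+ p = 1 -> subgroup H ->
  x != 0%R -> H (fpow g x) -> H (fpow g y).
Proof.
move=> gp gH x0 Hx; have -> : y = (x * ((x^-1 * y)%R : nat)%:R)%R.
  by rewrite natr_Zp mulrA divff ?mul1r.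
by rewrite -fpowX //; apply: subgroupX.
Qed.

Lemma fpowJ g h x : fpow (g ^ h) x = fpow g x ^ h.
Proof. by rewrite /fpow conjXg. Qed.

End FpPowers.

(** * First-level action and sections *)

Section LettersOfFp.
Variable p : nat.
Hypothesis pr_p : prime p.
Let F := 'F_p.
Implicit Types (z t : F) (g h : tree_aut p).

(** In this coordinate [ordS] is the addition of 1 and the last letter, where
    b has the section b, is the origin. *)
Definition position (x : 'I_p) : F := x.+1%:R%R.

Definition letter z : 'I_p := Ordinal (ltn_pmod (z + p.-1) (prime_gt0 pr_p)).

Lemma positionK : cancel position letter.
Proof.
move=> x; apply: val_inj; rewrite /= val_Fp_nat // modnDml addSn -addnS.
by rewrite prednK ?prime_gt0 // modnDr modn_small.
Qed.

Lemma letterK : cancel letter position.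
Proof.
move=> z; rewrite /position -addn1 natrD /= Fp_nat_mod // natrD natr_Zp.
by rewrite -addrA -natrD addn1 prednK ?prime_gt0 // pchar_Fp_0 // addr0.
Qed.

Lemma position_ordS x : position (ordS x) = (position x + 1)%R.
Proof.
by rewrite /position -addn1 natrD /= Fp_nat_mod.
Qed.

Definition sec z g := aut_section [:: letter z] g.

(** The displacement of the letter 0, hence of every letter for the elements
    that act on the first level by a translation, called rigid below. *)
Definition turn g : F := position (head (letter 0%R) (g [:: letter 0%R])).

Definition rigid g := forall z, g [:: letter z] = [:: letter (z + turn g)%R].

Lemma rigidP g r :
  (forall z, g [:: letter z] = [:: letter (z + r)%R]) -> turn g = r /\ rigid g.
Proof.
move=> gr; have rg : turn g = r by rewrite /turn gr /= add0r letterK.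
by split=> // z; rewrite gr rg.
Qed.

Lemma rigid1 : rigid 1.
Proof. by apply: (proj2 (@rigidP 1 0%R _)) => z; rewrite addr0. Qed.

Lemma turn1 : turn 1 = 0%R.
Proof. by apply: (proj1 (@rigidP 1 0%R _)) => z; rewrite addr0. Qed.

Lemma rigidM_subproof g h : rigid g -> rigid h ->
  turn (g * h) = (turn g + turn h)%R /\ rigid (g * h).
Proof.
by move=> rg rh; apply: rigidP => z;
  rewrite autME rh rg -addrA [(turn h + _)%R]addrC.
Qed.

Lemma rigidM g h : rigid g -> rigid h -> rigid (g * h).
Proof. by move=> rg rh; case: (rigidM_subproof rg rh). Qed.

Lemma turnM g h : rigid g -> rigid h -> turn (g * h) = (turn g + turn h)%R.
Proof. by move=> rg rh; case: (rigidM_subproof rg rh). Qed.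

Lemma rigidV_subproof g : rigid g -> turn g^-1 = (- turn g)%R /\ rigid g^-1.
Proof.
move=> rg; apply: rigidP => z; apply: (can_inj (aut_funK g)).
by rewrite -autME mulgV rg subrK.
Qed.

Lemma rigidV g : rigid g -> rigid g^-1.
Proof. by move=> rg; case: (rigidV_subproof rg). Qed.

Lemma turnV g : rigid g -> turn g^-1 = (- turn g)%R.
Proof. by move=> rg; case: (rigidV_subproof rg). Qed.

Lemma subgroup_rigid : subgroup [set g | rigid g].
Proof.
by apply: subgroup_intro; [exact: rigid1 | exact: rigidM | exact: rigidV].
Qed.

Lemma secE g z w : g (letter z :: w) = g [:: letter z] ++ sec z g w.
Proof. exact: (section_funE g [:: letter z] w). Qed.

Lemma sec_unique z g h :
  (forall w, g (letter z :: w) = g [:: letter z] ++ h w) -> sec z g = h.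
Proof. by move=> gh; apply/esym/aut_sectionP. Qed.

Lemma secM z g h : rigid h -> sec z (g * h) = sec (z + turn h)%R g * sec z h.
Proof.
move=> rh; apply: sec_unique => w.
by rewrite !autME secE rh /= secE.
Qed.

Lemma sec1 z : sec z 1 = 1.
Proof. exact: sec_unique. Qed.

Lemma secV z g : rigid g -> sec z g^-1 = (sec (z - turn g)%R g)^-1.
Proof.
move=> rg; apply: (mulgI (sec (z - turn g)%R g)); rewrite mulgV.
by rewrite -turnV // -secM ?mulgV ?sec1 //; apply: rigidV.
Qed.

End LettersOfFp.

(** * The two generators and the group they generate *)

Section GeneratorFacts.
Variables (p : nat) (e : 'rV['F_p]_p.-1).
Hypothesis pr_p : prime p.
Let F := 'F_p.
Local Notation a := (ggs_a p).
Local Notation b := (ggs_b e).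
Local Notation G := (GGS e).
Local Notation letter := (letter pr_p).
Local Notation sec := (sec pr_p).
Local Notation turn := (turn pr_p).
Local Notation rigid := (rigid pr_p).
Implicit Types (z t : F) (g h : tree_aut p).

(** The defining vector in the coordinate of the letters, extended by 0 at the
    origin: this is the turn of every section of b, including the one that is
    b itself. *)
Definition exponent z : F :=
  if insub (letter z : nat) is Some i then e ord0 i else 0%R.
Local Notation E := exponent.

Lemma letterS z : ordS (letter z) = letter (z + 1)%R.
Proof. by rewrite -[LHS](positionK pr_p) position_ordS // letterK. Qed.

Lemma turn_a_subproof : turn a = 1%R /\ rigid a.
Proof. by apply: rigidP => z; rewrite -letterS. Qed.

Lemma turn_b_subproof : turn b = 0%R /\ rigid b.
Proof.
apply: rigidP => z; rewrite addr0 /=; case: insubP => //= i _ _.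
by rewrite aut_root.
Qed.

Lemma rigid_a : rigid a. Proof. by case: turn_a_subproof. Qed.
Lemma rigid_b : rigid b. Proof. by case: turn_b_subproof. Qed.
Lemma turn_a : turn a = 1%R. Proof. by case: turn_a_subproof. Qed.
Lemma turn_b : turn b = 0%R. Proof. by case: turn_b_subproof. Qed.

Lemma sec_a z : sec z a = 1.
Proof. exact: sec_unique. Qed.

Lemma letter_last z :
  insub (letter z : nat) = None :> option 'I_p.-1 <-> z = 0%R.
Proof.
case: insubP => [i lt_zp _|/negP ge_zp]; split=> //.
  move=> z0; move: lt_zp; rewrite z0 /= add0n modn_small ?ltnn //.
  by rewrite ltn_predL prime_gt0.
move=> _; rewrite -(letterK pr_p z) /position -[RHS](pchar_Fp_0 pr_p).
have lt_z := ltn_ord (letter z).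
have -> : (letter z).+1 = p; last by [].
move: (nat_of_ord (letter z)) lt_z ge_zp => k; have := prime_gt0 pr_p; lia.
Qed.

Lemma exponent0 : E 0%R = 0%R.
Proof. by rewrite /E (iffRL (letter_last 0%R) erefl). Qed.

Lemma sec_b z : sec z b = if z == 0%R then b else fpow a (E z).
Proof.
apply: sec_unique => w /=; congr cons; rewrite /E.
have := letter_last z.
case: insubP => [i lt_zp _|ge_zp] zP; case: eqP => z0 //=.
- by have := iffRL zP z0.
- by rewrite aut_root.
- by have := iffLR zP erefl.
Qed.

Lemma expa_p : a ^+ p = 1.
Proof.
have aX k x w : (a ^+ k) (x :: w) = iter k (@ordS p) x :: w.
  by elim: k => [|k IHk]; rewrite ?expg0 // expgS autME IHk.
have posX k x : position (iter k (@ordS p) x) = (position x + k%:R)%R.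
  elim: k => [|k IHk] /=; first by rewrite addr0.
  by rewrite position_ordS // IHk -natr1 addrA.
apply: tree_aut_ext => -[|x w]; first by rewrite !aut_root.
rewrite aX -[iter _ _ _](positionK pr_p) posX pchar_Fp_0 // addr0.
by rewrite positionK.
Qed.

Lemma expb_p : b ^+ p = 1.
Proof.
have bX k x w : (b ^+ k) (x :: w) =
    x :: (if insub (x : nat) is Some i then (fpow a (e ord0 i) ^+ k) w
          else (b ^+ k) w).
  elim: k => [|k IHk]; first by rewrite !expg0; case: insubP.
  by rewrite !expgS autME IHk /=; case: insubP => // i _ _; rewrite expgS.
apply: tree_aut_ext; elim=> [|x w IHw]; first by rewrite !aut_root.
rewrite bX; congr cons; case: insubP => // i _ _.
by rewrite fpowX ?expa_p // pchar_Fp_0 // mulr0 fpow0.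
Qed.

Lemma subgroup_GGS : subgroup G.
Proof. exact: subgroup_generated. Qed.

Lemma GGS_a : G a. Proof. by apply: sub_generated; left. Qed.
Lemma GGS_b : G b. Proof. by apply: sub_generated; right. Qed.

Lemma GGS_min (H : set (tree_aut p)) : subgroup H -> H a -> H b -> G `<=` H.
Proof. by move=> gH Ha Hb; apply: generated_min => // _ [|] ->. Qed.

Lemma GGS_rigid g : G g -> rigid g.
Proof.
move=> Gg; apply: GGS_min g Gg; [exact: subgroup_rigid | exact: rigid_a |
  exact: rigid_b].
Qed.

Lemma GGS_fpow_a (x : F) : G (fpow a x).
Proof. exact: (subgroupX _ subgroup_GGS GGS_a). Qed.
Lemma GGS_fpow_b (x : F) : G (fpow b x).
Proof. exact: (subgroupX _ subgroup_GGS GGS_b). Qed.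

Lemma GGS_ind (P : tree_aut p -> Prop) :
  P 1 -> P a -> P b ->
  (forall g h, G g -> G h -> P g -> P h -> P (g * h)) ->
  (forall g, G g -> P g -> P g^-1) -> forall g, G g -> P g.
Proof.
move=> P1 Pa Pb PM PV g Gg.
have gG := subgroup_GGS.
suff /(_ g Gg)[] : G `<=` [set g | G g /\ P g] by [].
apply: GGS_min => /=; [|by split; [exact: GGS_a|]|by split; [exact: GGS_b|]].
apply: subgroup_intro => /= [|x y [Gx Px] [Gy Py]|x [Gx Px]].
- by split=> //; exact: (subgroup1 gG).
- by split; [apply: (subgroupM gG)|apply: PM].
- by split; [apply: (subgroupV gG)|apply: PV].
Qed.

Lemma GGS_sec z g : G g -> G (sec z g).
Proof.
have gG := subgroup_GGS.
move=> Gg; move: g Gg z; apply: GGS_ind =>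
  [z|z|z|g h Gg Gh IHg IHh z|g Gg IHg z].
- by rewrite sec1; exact: (subgroup1 gG).
- by rewrite sec_a; exact: (subgroup1 gG).
- by rewrite sec_b; case: ifP => _; [exact: GGS_b | exact: GGS_fpow_a].
- by rewrite secM; [apply: (subgroupM gG) | apply: GGS_rigid].
- by rewrite secV; [apply: (subgroupV gG) | apply: GGS_rigid].
Qed.

Lemma self_similar_GGS : self_similar G.
Proof.
split=> [|v]; first exact: subgroup_GGS.
elim: v => [|x v IHv] _ [g Gg <-].
  suff -> : aut_section [::] g = g by [].
  by apply/esym/aut_sectionP => w; rewrite aut_root.
suff -> : aut_section (x :: v) g = aut_section v (sec (position x) g).
  by apply: IHv; exists (sec (position x) g) => //; apply: GGS_sec.
apply/esym/aut_sectionP => w; have gE w := secE pr_p g (position x) w.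
rewrite positionK in gE; rewrite cat_cons [LHS]gE (gE v) -catA.
congr (_ ++ _); exact: section_funE.
Qed.

End GeneratorFacts.

(** * The homomorphisms to F_p *)

(** An element of nonzero turn permutes the letters in one cycle, so a p-th
    power visits each of them once. *)
Lemma big_orbit_Fp (R : Type) (idx : R) (op : Monoid.com_law idx) (p : nat)
    (f : 'F_p -> R) (z r : 'F_p) : prime p -> r != 0%R ->
  \big[op/idx]_(i < p) f (z + i%:R * r)%R = \big[op/idx]_w f w.
Proof.
move=> pr_p r0; rewrite -(big_mkord xpredT (fun i => f (z + i%:R * r)%R)).
rewrite -{1}(Fp_cast pr_p) big_mkord.
rewrite [RHS](reindex_inj (inj_comp (addrI z) (mulIf r0))) /=.
by apply: eq_bigr => i _; rewrite natr_Zp.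
Qed.

Section Abelianization.
Variables (p : nat) (e : 'rV['F_p]_p.-1).
Hypotheses (pr_p : prime p) (e_neq0 : e != 0%R).
Let F := 'F_p.
Local Notation a := (ggs_a p).
Local Notation b := (ggs_b e).
Local Notation G := (GGS e).
Local Notation sec := (sec pr_p).
Local Notation turn := (turn pr_p).
Local Notation rigid := (rigid pr_p).
Local Notation E := (exponent e pr_p).
Implicit Types (z t w r : F) (g h : tree_aut p).

Lemma exponent_neq0 : exists z, E z != 0%R.
Proof.
have [i ei] : exists i, e ord0 i != 0%R.
  apply: contrapT => /forallNP e0; case/negP: e_neq0; apply/eqP/rowP => i.
  by rewrite mxE; apply/eqP; apply: contra_notT (e0 i).
have lt_ip : (i < p)%N by apply: leq_trans (ltn_ord i) (leq_pred p).
exists (position (Ordinal lt_ip)); rewrite /exponent positionK /=.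
by rewrite valK.
Qed.

Lemma turnX g n : rigid g -> turn (g ^+ n) = (n%:R * turn g)%R.
Proof.
move=> rg; elim: n => [|n IHn]; first by rewrite expg0 turn1 mul0r.
have rgn := subgroupX n (@subgroup_rigid _ pr_p) rg.
by rewrite expgS turnM ?IHn // -natr1 mulrDl mul1r addrC.
Qed.

Lemma turn_fpow_a (x : F) : turn (fpow a x) = x.
Proof. by rewrite turnX ?turn_a ?mulr1 ?natr_Zp //; apply: rigid_a. Qed.

Lemma turn_fpow_b (x : F) : turn (fpow b x) = 0%R.
Proof. by rewrite turnX ?turn_b ?mulr0 //; apply: rigid_b. Qed.

Lemma turn_sec_b z : turn (sec z b) = E z.
Proof.
rewrite sec_b; case: eqP => [->|_]; last exact: turn_fpow_a.
by rewrite turn_b exponent0.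
Qed.

(** The functional that recovers the exponent sum of b of an element from the
    turns of its sections; it takes the value 1 on the exponent vector. *)
Definition weight : F -> F :=
  sval (cid (invariant_functional pr_p exponent_neq0)).

Lemma weight_exponent t : (\sum_z weight (z + t) * E z = 1)%R.
Proof. by rewrite /weight; case: cid => q /= []. Qed.

Definition bdeg g : F := (\sum_z weight z * turn (sec z g))%R.

Lemma turn_secM z g h : G g -> G h ->
  turn (sec z (g * h)) = (turn (sec (z + turn h) g) + turn (sec z h))%R.
Proof.
by move=> Gg Gh; rewrite secM ?turnM //; apply: (@GGS_rigid _ e) => //;
  apply: GGS_sec.
Qed.

Lemma turn_secV z g : G g ->
  turn (sec z g^-1) = (- turn (sec (z - turn g) g))%R.
Proof.
by move=> Gg; rewrite secV ?turnV //; apply: (@GGS_rigid _ e) => //;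
  apply: GGS_sec.
Qed.

(** The turns of the sections of a product g h are those of g, translated by
    the turn of h, plus those of h.  So the functional is additive on G
    because it is translation invariant on these vectors, and it is so because
    it is on the vectors of the generators. *)
Lemma bdeg_shift g t : G g ->
  (\sum_z weight (z + t) * turn (sec z g))%R = bdeg g.
Proof.
move=> Gg; move: g Gg t.
suff H g : G g -> forall t s, (\sum_z weight (z + t) * turn (sec z g) =
                        \sum_z weight (z + s) * turn (sec z g))%R.
  move=> g Gg t; rewrite (H g Gg t 0%R) /bdeg.
  by apply: eq_bigr => z _; rewrite addr0.
move: g; apply: GGS_ind => [t s|t s|t s|g h Gg Gh IHg IHh t s|g Gg IHg t s].
- by apply: eq_bigr => z _; rewrite sec1 turn1 !mulr0.
- by apply: eq_bigr => z _; rewrite sec_a turn1 !mulr0.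
- under eq_bigr => z _ do rewrite turn_sec_b; rewrite weight_exponent.
  by under eq_bigr => z _ do rewrite turn_sec_b; rewrite weight_exponent.
- have split u : (\sum_z weight (z + u) * turn (sec z (g * h)%g) =
     \sum_z weight (z + (u - turn h)) * turn (sec z g) +
     \sum_z weight (z + u) * turn (sec z h))%R.
    under eq_bigr => z _ do rewrite turn_secM // mulrDr.
    rewrite big_split /= -[X in (_ = X + _)%R](sum_shift _ (turn h)).
    by congr (_ + _)%R; apply: eq_bigr => z _; rewrite addrACA subrr addr0.
  by rewrite !split (IHg _ (s - turn h)%R) (IHh _ s).
- have inv u : (\sum_z weight (z + u) * turn (sec z g^-1%g) =
     - \sum_z weight (z + (u + turn g)) * turn (sec z g))%R.
    under eq_bigr => z _ do rewrite turn_secV // mulrN.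
    rewrite sumrN -[X in (_ = - X)%R](sum_shift _ (- turn g)%R).
    by congr (- _)%R; apply: eq_bigr => z _; rewrite addrACA addNr addr0.
  by rewrite !inv (IHg _ (s + turn g)%R).
Qed.

Lemma bdegM g h : G g -> G h -> bdeg (g * h) = (bdeg g + bdeg h)%R.
Proof.
move=> Gg Gh; rewrite {1}/bdeg.
under eq_bigr => z _ do rewrite turn_secM // mulrDr.
rewrite big_split /=; congr (_ + _)%R.
rewrite -(bdeg_shift (- turn h)%R Gg) -[RHS](sum_shift _ (turn h)).
by apply: eq_bigr => z _; rewrite addrK.
Qed.

Lemma bdeg1 : bdeg 1 = 0%R.
Proof. by rewrite /bdeg big1 // => z _; rewrite sec1 turn1 mulr0. Qed.

Lemma bdegV g : G g -> bdeg g^-1 = (- bdeg g)%R.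
Proof.
move=> Gg; apply: (addrI (bdeg g)); rewrite subrr -bdegM ?mulgV ?bdeg1 //.
exact: (subgroupV (@subgroup_GGS p e)).
Qed.

Lemma bdegX g n : G g -> bdeg (g ^+ n) = (n%:R * bdeg g)%R.
Proof.
move=> Gg; elim: n => [|n IHn]; first by rewrite expg0 bdeg1 mul0r.
rewrite expgS bdegM ?IHn //; first by rewrite -natr1 mulrDl mul1r addrC.
exact: (subgroupX n (@subgroup_GGS p e)).
Qed.

Lemma bdeg_a : bdeg a = 0%R.
Proof. by rewrite /bdeg big1 // => z _; rewrite sec_a turn1 mulr0. Qed.

Lemma bdeg_b : bdeg b = 1%R.
Proof.
rewrite -(bdeg_shift 0%R (@GGS_b p e)) -[RHS](weight_exponent 0%R).
by apply: eq_bigr => z _; rewrite turn_sec_b.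
Qed.

Lemma bdeg_fpow_a (x : F) : bdeg (fpow a x) = 0%R.
Proof. by rewrite bdegX ?bdeg_a ?mulr0 //; apply: GGS_a. Qed.

Lemma bdeg_fpow_b (x : F) : bdeg (fpow b x) = x.
Proof. by rewrite bdegX ?bdeg_b ?mulr1 ?natr_Zp //; apply: GGS_b. Qed.

Lemma bdeg_secM z g h : G g -> G h ->
  bdeg (sec z (g * h)) = (bdeg (sec (z + turn h) g) + bdeg (sec z h))%R.
Proof.
by move=> Gg Gh; rewrite secM ?bdegM //;
  first [apply: GGS_sec|apply: (@GGS_rigid _ e)].
Qed.

Lemma bdeg_secV z g : G g ->
  bdeg (sec z g^-1) = (- bdeg (sec (z - turn g) g))%R.
Proof.
by move=> Gg; rewrite secV ?bdegV //;
  first [apply: GGS_sec|apply: (@GGS_rigid _ e)].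
Qed.

Lemma bdeg_sec_b z : bdeg (sec z b) = (z == 0)%:R%R.
Proof. by rewrite sec_b; case: eqP => _; rewrite ?bdeg_b ?bdeg_fpow_a. Qed.

(** A syllable b^x conjugated by a power of a has b^x as section at a single
    letter, and powers of a elsewhere. *)
Lemma sum_bdeg_sec g : G g -> (\sum_z bdeg (sec z g))%R = bdeg g.
Proof.
move: g; apply: GGS_ind => [|||g h Gg Gh IHg IHh|g Gg IHg].
- by rewrite big1 ?bdeg1 // => z _; rewrite sec1 bdeg1.
- by rewrite big1 ?bdeg_a // => z _; rewrite sec_a bdeg1.
- rewrite (bigD1 0%R) //= big1 => [|z /negPf z0]; rewrite bdeg_sec_b ?z0 //.
  by rewrite eqxx addr0 bdeg_b.
- under eq_bigr => z _ do rewrite bdeg_secM //.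
  by rewrite big_split /= IHh (sum_shift (fun z => bdeg (sec z g))) IHg bdegM.
- under eq_bigr => z _ do rewrite bdeg_secV //.
  by rewrite sumrN (sum_shift (fun z => bdeg (sec z g))) IHg bdegV.
Qed.

(** A section b^x at the letter i comes with the sections a^(x E(w - i)) at
    the letters w different from i. *)
Lemma turn_sec g w : G g ->
  turn (sec w g) = conv E (fun z => bdeg (sec z g)) w.
Proof.
move=> Gg; move: g Gg w; rewrite /conv.
apply: GGS_ind => [w|w|w|g h Gg Gh IHg IHh w|g Gg IHg w].
- by rewrite sec1 turn1 big1 // => z _; rewrite sec1 bdeg1 mul0r.
- by rewrite sec_a turn1 big1 // => z _; rewrite sec_a bdeg1 mul0r.
- rewrite turn_sec_b (bigD1 0%R) //= big1 => [|z /negPf z0].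
    by rewrite bdeg_sec_b eqxx mul1r subr0 addr0.
  by rewrite bdeg_sec_b z0 mul0r.
- rewrite turn_secM // IHg IHh.
  under [RHS]eq_bigr => z _ do rewrite bdeg_secM // mulrDl.
  rewrite big_split /= -[X in (X + _ = _)%R](sum_shift _ (turn h)).
  by congr (_ + _)%R; apply: eq_bigr => z _; rewrite opprD addrACA subrr addr0.
- rewrite turn_secV // IHg.
  under [RHS]eq_bigr => z _ do rewrite bdeg_secV // mulNr.
  rewrite sumrN -[X in (- X = _)%R](sum_shift _ (- turn g)%R).
  by congr (- _)%R; apply: eq_bigr => z _; rewrite opprB addrA subrK.
Qed.

Lemma sec_expg_hom (phi : tree_aut p -> F) z g n : 
  phi 1 = 0%R ->
  (forall x y, G x -> G y -> phi (x * y) = (phi x + phi y)%R) -> G g ->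
  phi (sec z (g ^+ n)) = (\sum_(i < n) phi (sec (z + i%:R * turn g) g))%R.
Proof.
move=> phi1 phiM Gg; have gG := @subgroup_GGS p e.
elim: n => [|n IHn]; first by rewrite expg0 sec1 big_ord0.
have GX := subgroupX n gG Gg.
have RX := GGS_rigid pr_p GX.
rewrite expgS secM // phiM ?IHn ?big_ord_recr /=; try exact: GGS_sec.
by rewrite addrC turnX //; apply: (GGS_rigid pr_p Gg).
Qed.

(** A section of g^p is the product of all the sections of g, in some order. *)
Lemma turn_sec_expp z g : G g -> turn g != 0%R ->
  turn (sec z (g ^+ p)) = (bdeg g * \sum_w E w)%R.
Proof.
move=> Gg rg; rewrite sec_expg_hom // ?turn1 //; last first.
  by move=> x y Gx Gy; apply: turnM; apply: (@GGS_rigid _ e).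
rewrite (big_orbit_Fp _ (fun w => turn (sec w g))) //.
under eq_bigr => w _ do rewrite turn_sec // /conv.
rewrite exchange_big -(sum_bdeg_sec Gg) mulr_suml; apply: eq_bigr => i _.
by rewrite /= -mulr_sumr (sum_shift E).
Qed.

Lemma bdeg_sec_expp z g : G g -> turn g != 0%R ->
  bdeg (sec z (g ^+ p)) = bdeg g.
Proof.
move=> Gg rg; rewrite sec_expg_hom ?bdeg1 //; last exact: bdegM.
by rewrite (big_orbit_Fp _ (fun w => bdeg (sec w g))) // sum_bdeg_sec.
Qed.

(** If the sum is nonzero, the elements with nonzero turn and nonzero b-degree
    are stable under taking a section of the p-th power.  As the order of such
    an element is divisible by p, this divides the order by p forever. *)
Lemma torsion_sum_exponent : torsion G -> (\sum_w E w = 0)%R.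
Proof.
move=> torG; apply/eqP; apply: contrapT => /negP sumE.
have gG := @subgroup_GGS p e.
(* In the induction, n is an exponent of g. *)
have noX n g : G g -> turn g != 0%R -> bdeg g != 0%R -> (0 < n)%N ->
  g ^+ n <> 1.
  elim/ltn_ind: n g => n IHn g Gg rg dg n_gt0 gn.
  have : (n%:R * turn g = 0)%R.
    by rewrite -turnX ?gn ?turn1 //; apply: (GGS_rigid pr_p Gg).
  move=> /eqP; rewrite mulf_eq0 (negPf rg) orbF => /eqP n0.
  have /dvdnP[m defn] : (p %| n)%N by rewrite (dvdn_pcharf (pchar_Fp pr_p)) n0.
  have Gp := subgroupX p gG Gg.
  have m_gt0 : (0 < m)%N by move: n_gt0; rewrite defn muln_gt0 => /andP[].
  apply: (IHn m _ (sec 0%R (g ^+ p))) => //.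
  - by rewrite defn ltn_Pmulr // prime_gt1.
  - exact: GGS_sec.
  - by rewrite turn_sec_expp // mulf_neq0.
  - by rewrite bdeg_sec_expp.
  have : sec 0%R (g ^+ n) = 1 by rewrite gn sec1.
  rewrite defn mulnC expgnA => <-; elim: m {m_gt0 defn} => [|m IHm].
    by rewrite !expg0 sec1.
  have turn_gp : turn (g ^+ p) = 0%R.
    by rewrite turnX ?pchar_Fp_0 ?mul0r //; apply: (GGS_rigid pr_p Gg).
  rewrite !expgSr secM ?turn_gp ?addr0 ?IHm //; exact: (GGS_rigid pr_p Gp).
have Gab : G (a * b) by apply: (subgroupM gG); [exact: GGS_a | exact: GGS_b].
have [n n_gt0 abn] := torG _ Gab.
apply: noX abn => //.
- by rewrite turnM ?turn_a ?turn_b ?addr0 ?oner_neq0 //;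
  [exact: rigid_a|exact: rigid_b].
- rewrite bdegM ?bdeg_a ?bdeg_b ?add0r ?oner_neq0 //; [exact: GGS_a |
  exact: GGS_b].
Qed.

End Abelianization.

(** * Syllable length *)

Section SyllableLength.
Variables (p : nat) (e : 'rV['F_p]_p.-1).
Hypothesis pr_p : prime p.
Let F := 'F_p.
Local Notation a := (ggs_a p).
Local Notation b := (ggs_b e).
Local Notation G := (GGS e).
Local Notation sec := (sec pr_p).
Local Notation turn := (turn pr_p).
Local Notation E := (exponent e pr_p).
Implicit Types (z w : F) (g h t : tree_aut p).

(** Exponents may vanish, so these sets increase with n. *)
Fixpoint syl n : set (tree_aut p) :=
  if n is n'.+1 then
    [set g | exists h (x y : F), syl n' h /\ g = h * (fpow b x * fpow a y)]
  else [set g | exists x : F, g = fpow a x].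

Let aD (x y : F) := fpowD pr_p x y (expa_p pr_p).
Let bD (x y : F) := fpowD pr_p x y (expb_p e pr_p).

Lemma syl_GGS n g : syl n g -> G g.
Proof.
have gG := @subgroup_GGS p e.
elim: n g => [|n IHn] g /=; first by case=> x ->; apply: GGS_fpow_a.
case=> h [x [y [/IHn Gh ->]]]; apply: (subgroupM gG) => //.
by apply: (subgroupM gG); [apply: GGS_fpow_b | apply: GGS_fpow_a].
Qed.

Lemma syl_a n (x : F) : syl n (fpow a x).
Proof.
elim: n => [|n IHn] /=; first by exists x.
by exists (fpow a x), 0%R, 0%R; rewrite !fpow0 !mulg1.
Qed.

Lemma syl_le m n g : (m <= n)%N -> syl m g -> syl n g.
Proof.
move=> /subnK <-; elim: (n - m)%N => // k IHk /IHk Sg.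
by exists g, 0%R, 0%R; rewrite !fpow0 !mulg1.
Qed.

Lemma sylM m n g h : syl m g -> syl n h -> syl (m + n) (g * h).
Proof.
move=> Sg; elim: n h => [|n IHn] h /=; last first.
  case=> h' [x [y [/IHn Sh ->]]]; rewrite addnS /=.
  by exists (g * h'), x, y; rewrite mulgA.
case=> y ->; rewrite addn0; case: m Sg => [|m] /= [].
  by move=> x ->; exists (x + y)%R; rewrite aD.
move=> h' [x [u [Sh ->]]]; exists h', x, (u + y)%R.
by rewrite aD !mulgA.
Qed.

Lemma syl_b (x : F) : syl 1 (fpow b x).
Proof.
exists 1, x, 0%R; rewrite fpow0 mulg1 mul1g; split=> //.
by exists 0%R; rewrite fpow0.
Qed.

Lemma sylV n g : syl n g -> syl n g^-1.
Proof.
elim: n g => [|n IHn] g /=.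
  by case=> x ->; exists (- x)%R; rewrite (fpowN pr_p) ?expa_p.
case=> h [x [y [/IHn Sh ->]]]; rewrite !invgM -(fpowN pr_p) ?expa_p //.
rewrite -(fpowN pr_p) ?expb_p //; apply: (@sylM 1 n) => //.
exact: (sylM (syl_a 0 _) (syl_b _)).
Qed.

Lemma GGS_syl g : G g -> exists n, syl n g.
Proof.
move: g; apply: GGS_ind => [|||g h _ _ [m Sg] [n Sh]|g _ [n Sg]].
- by exists 0%N, 0%R; rewrite fpow0.
- by exists 0%N, 1%R; rewrite fpow1.
- by exists 1%N; rewrite -(fpow1 pr_p b); apply: syl_b.
- by exists (m + n)%N; apply: sylM.
- by exists n; apply: sylV.
Qed.

Lemma sec_fpow_a z (x : F) : sec z (fpow a x) = 1.
Proof.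
rewrite /fpow; elim: (x : nat) z => [|n IHn] z; first by rewrite expg0 sec1.
by rewrite expgSr secM ?sec_a ?mulg1; [exact: IHn | exact: rigid_a].
Qed.

Lemma sec_fpow_b z (x : F) :
  sec z (fpow b x) = if z == 0%R then fpow b x else fpow a (E z * x)%R.
Proof.
rewrite -{2 3}(natr_Zp x) (_ : fpow b x = b ^+ x) //.
elim: (x : nat) => [|n IHn].
  by rewrite expg0 sec1 mulr0 !fpow0; case: ifP.
rewrite expgSr secM ?turn_b ?addr0 ?IHn ?sec_b; last exact: rigid_b.
rewrite -natr1 mulrDr mulr1 bD aD; case: ifP => _ //.
Qed.

Lemma sec_syllable z (x y : F) :
  sec z (fpow b x * fpow a y) = sec (z + y)%R (fpow b x).
Proof.
rewrite secM ?sec_fpow_a ?mulg1 ?turn_fpow_a //.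
by apply: (@GGS_rigid _ e); apply: GGS_fpow_a.
Qed.

Lemma syl_sec1 z g : syl 1 g ->
  (exists x : F, sec z g = fpow a x) \/ (exists x : F, sec z g = fpow b x).
Proof.
case=> _ [x [y [[u ->] ->]]]; rewrite secM; last first.
  apply: (@GGS_rigid _ e); apply: (@syl_GGS 1).
  by apply: (@sylM 1 0); [exact: syl_b | exact: syl_a].
rewrite sec_fpow_a mul1g sec_syllable sec_fpow_b.
by case: ifP => _; [right; exists x | left; exists (E (z + y)%R * x)%R].
Qed.

(** Each syllable has as section a power of a or a power of b; the product of
    the sections of two consecutive syllables has at most one syllable. *)
Lemma syl_sec n z g : syl n g -> syl (uphalf n) (sec z g).
Proof.
have split1 m h : syl m.+1 h ->
    exists h1 h2, [/\ syl m h1, syl 1 h2 & h = h1 * h2].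
  move=> [h' [x [y [Sh ->]]]]; exists h', (fpow b x * fpow a y).
  by split=> //; apply: (@sylM 1 0); [exact: syl_b | exact: syl_a].
have rS m h : syl m h -> rigid pr_p h by move/syl_GGS/(GGS_rigid pr_p).
elim/ltn_ind: n z g => -[|[|n]] IHn z g.
- by case=> x ->; rewrite sec_fpow_a; exists 0%R; rewrite fpow0.
- by case/(syl_sec1 z) => -[x ->]; [exact: syl_a | exact: syl_b].
case/split1 => h [g2 [+ S2 ->]]; case/split1 => g0 [g1 [S0 S1 ->]].
have S01 := sylM S0 S1.
rewrite secM ?secM; try by apply: rS; eassumption.
rewrite -mulgA (_ : uphalf n.+2 = uphalf n + 1)%N ?addn1 // -addn1;
  apply: sylM; first exact: IHn.
case: (syl_sec1 (z + turn g2)%R S1) => -[x ->];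
  case: (syl_sec1 z S2) => -[y ->].
- by rewrite -aD; exact: syl_a.
- exact: (sylM (syl_a 0 _) (syl_b _)).
- exact: (sylM (syl_b _) (syl_a 0 _)).
- by rewrite -bD; exact: syl_b.
Qed.

(** Among the sections of three syllables, two adjacent powers of b merge; the
    only way to keep two syllables is the pattern b, a, b. *)
Lemma syl_sec3 z g : syl 3 g ->
  syl 1 (sec z g) \/ exists x k y : F, sec z g = fpow b x * fpow a k * fpow b y.
Proof.
case=> h [x [y [Sh ->]]].
have rigid_ba (u v : F) : rigid pr_p (fpow b u * fpow a v).
  apply: (@GGS_rigid _ e); apply: (subgroupM (@subgroup_GGS p e)).
    exact: GGS_fpow_b.
  exact: GGS_fpow_a.
rewrite secM // sec_syllable sec_fpow_b.
set z2 := (z + turn _)%R; case: ifP => _; last first.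
  left; apply: (@sylM 1 0); last exact: syl_a.
  exact: (@syl_sec 2 z2 h Sh).
move: Sh => /= [_ [x2 [y2 [[_ [x1 [y1 [[u ->] ->]]]] ->]]]].
rewrite !(@secM _ pr_p _ _ _ (rigid_ba _ _)) !sec_syllable sec_fpow_a mul1g
  !sec_fpow_b.
case: ifP => _; case: ifP => _.
- by left; rewrite -!bD; exact: syl_b.
- by right; exists x1, (E (z2 + y2) * x2)%R, x.
- by left; rewrite -mulgA -bD; apply: (sylM (syl_a 0 _) (syl_b _)).
- by left; rewrite -aD; apply: (sylM (syl_a 0 _) (syl_b _)).
Qed.

(** Each syllable is a power of b in the section at one letter only. *)
Lemma syl_weights n g : syl n g -> exists l : F -> nat,
  (\sum_z l z <= n)%N /\ forall z, syl (l z) (sec z g).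
Proof.
elim: n g => [|n IHn] g /=.
  by case=> x ->; exists (fun=> 0%N); rewrite big1 //; split=> // z;
    rewrite sec_fpow_a; exists 0%R; rewrite fpow0.
case=> h [x [y [/IHn[l [ln Sl]] ->]]].
exists (fun z => (l (z + y)%R + (z + y == 0)%R)%N); split=> [|z].
  rewrite big_split /= (big_shift _ l).
  rewrite (big_shift _ (fun z => nat_of_bool (z == 0%R))).
  rewrite (_ : \sum_(z : F) nat_of_bool (z == 0%R) = 1)%N => [|]; last first.
    by rewrite (bigD1 0%R) //= big1 // => z /negPf ->.
  by rewrite addn1.
have ay : rigid pr_p (fpow a y) by apply: (@GGS_rigid _ e); apply: GGS_fpow_a.
have bx : rigid pr_p (fpow b x) by apply: (@GGS_rigid _ e); apply: GGS_fpow_b.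
rewrite secM ?turnM ?turn_fpow_a ?turn_fpow_b ?add0r ?sec_syllable //;
  last exact: rigidM.
apply: sylM => //; rewrite sec_fpow_b; case: ifP => _; [exact: syl_b |
  exact: syl_a].
Qed.

End SyllableLength.

(** * Sections of the stabiliser of the first level *)

Section SectionSubgroups.
Variables (p : nat) (e : 'rV['F_p]_p.-1).
Hypothesis pr_p : prime p.
Let F := 'F_p.
Local Notation a := (ggs_a p).
Local Notation G := (GGS e).
Local Notation sec := (sec pr_p).
Local Notation turn := (turn pr_p).
Local Notation rigid := (rigid pr_p).
Local Notation syl := (syl e).
Implicit Types (z w : F) (g h t : tree_aut p) (H S : set (tree_aut p)).

Let gG : subgroup G := @subgroup_GGS p e.
Let rG g : G g -> rigid g := @GGS_rigid p e pr_p g.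

Let rH H g : H `<=` G -> H g -> rigid g.
Proof. by move=> HG Hg; exact: (rG (HG _ Hg)). Qed.

(** For subgroups of G: the turn vanishes when the first level is fixed. *)
Definition stab H := [set h | H h /\ turn h = 0%R].

Definition secgrp z H := [set sec z h | h in stab H].

Lemma turnJ g h : rigid g -> rigid h -> turn (h ^ g) = turn h.
Proof.
move=> Rg Rh; rewrite conjgE turnM ?turnV ?turnM //;
  first by rewrite addrC addrK.
- exact: rigidV.
- exact: rigidM.
Qed.

Lemma sec_stabJ z g h : rigid g -> rigid h -> turn h = 0%R ->
  sec z (h ^ g) = sec (z + turn g)%R h ^ sec z g.
Proof.
move=> Rg Rh h0; have Rhg : rigid (h * g) by apply: rigidM.
by rewrite !conjgE !secM ?turnM ?h0 ?add0r ?secV // addrK.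
Qed.

Lemma subgroup_stab H : subgroup H -> H `<=` G -> subgroup (stab H).
Proof.
move=> gH HG; apply: subgroup_intro => [|x y [Hx x0] [Hy y0]|x [Hx x0]].
- by split; [apply: subgroup1 | rewrite turn1].
- by split; [apply: (subgroupM gH) | rewrite turnM ?x0 ?y0 ?addr0 //;
  apply: (rH HG)].
- by split; [apply: (subgroupV gH) | rewrite turnV ?x0 ?oppr0 //;
  apply: (rH HG)].
Qed.

Lemma secgrp_sub z H : H `<=` G -> secgrp z H `<=` G.
Proof. by move=> HG _ [h [/HG Gh _] <-]; apply: GGS_sec. Qed.

Lemma sec_stabM z g h : G h -> turn h = 0%R -> sec z (g * h) =
  sec z g * sec z h.
Proof. by move=> /rG Rh h0; rewrite secM // h0 addr0. Qed.

Lemma subgroup_secgrp z H : subgroup H -> H `<=` G -> subgroup (secgrp z H).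
Proof.
move=> gH HG; have gS := subgroup_stab gH HG.
apply: subgroup_intro => [|_ _ [x Sx <-] [y Sy <-]|_ [x Sx <-]].
- by exists 1; [apply: (subgroup1 gS) | rewrite sec1].
- exists (x * y); first exact: (subgroupM gS).
  by case: Sy => /HG Gy y0; rewrite sec_stabM.
- exists x^-1; first exact: (subgroupV gS).
  by case: Sx => /HG Gx x0; rewrite secV ?x0 ?subr0 //; apply: rG.
Qed.

Lemma secgrp_conj z H g : subgroup H -> H `<=` G -> G g ->
  secgrp z [set x ^ g | x in H] =
  [set x ^ sec z g | x in secgrp (z + turn g)%R H].
Proof.
move=> gH HG Gg; have Rg := rG Gg.
have secJ h : H h -> turn h = 0%R ->
    sec z (h ^ g) = sec (z + turn g)%R h ^ sec z g.
  by move=> Hh; apply: sec_stabJ => //; apply: (rH HG).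
apply/seteqP; split=> [_ [_ [[h Hh <-] h0] <-]|_ [_ [h [Hh h0] <-] <-]].
  rewrite turnJ // in h0; last exact: (rH HG).
  by exists (sec (z + turn g)%R h); [exists h | rewrite secJ].
exists (h ^ g); last by rewrite secJ.
by split; [exists h | rewrite turnJ //; apply: (rH HG)].
Qed.

(** A power of h carries z to w, and conjugation by it preserves H. *)
Lemma secgrp_conj_in z w H h : subgroup H -> H `<=` G -> H h -> turn h != 0%R ->
  exists2 g, G g & secgrp z H = [set x ^ g | x in secgrp w H].
Proof.
move=> gH HG Hh h0; pose t := h ^+ ((w - z) / turn h : F)%R.
have Ht : H t by apply: subgroupX.
exists (sec z t); first by apply: GGS_sec; exact: HG.
rewrite -[in LHS](conj_set_id gH Ht) secgrp_conj //; last exact: HG.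
rewrite /t turnX; last exact: (rH HG).
by rewrite natr_Zp mulfVK // addrCA subrr addr0.
Qed.

(** The transversal t is indexed by its turns.  Once the products t(turn s +
    u)^-1 s t(u) are generated for s in S, they are for all s in the subgroup,
    by composing paths; u = 0 gives the stabiliser. *)
Lemma schreier S (t : F -> tree_aut p) : S `<=` G -> 
  t 0%R = 1 -> (forall u, generated S (t u) /\ turn (t u) = u) ->
  stab (generated S) =
  generated [set (t (turn s + u)%R)^-1 * (s * t u) | s in S & u in setT].
Proof.
move=> SG t0 tP; set N := generated [set _ | _ in _ & _ in _].
have gS := subgroup_generated S; have gN : subgroup N := subgroup_generated _.
have SGG : generated S `<=` G by apply: generated_min.
have Rt u : rigid (t u) by apply: (rH SGG); case: (tP u).
apply/seteqP; split.
  suff HP : generated S `<=` [set g | generated S g /\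
     forall u, N ((t (turn g + u)%R)^-1 * (g * t u))].
    move=> h [/HP[_ /(_ 0%R)]] + h0; by rewrite h0 addr0 t0 invg1 mul1g mulg1.
  apply: generated_min => [|s Ss]; last first.
    split=> [|u]; first exact: sub_generated.
    by apply: sub_generated; exists s => //; exists u.
  apply: subgroup_intro => [|g h [Sg Ng] [Sh Nh]|g [Sg Ng]].
  - split=> [|u]; first exact: (subgroup1 gS).
    by rewrite turn1 add0r mul1g mulVg; exact: (subgroup1 gN).
  - split=> [|u]; first exact: (subgroupM gS).
    have -> : (t (turn (g * h)%g + u)%R)^-1 * (g * h * t u) =
        (t (turn g + (turn h + u))%R)^-1 * (g * t (turn h + u)%R) *
        ((t (turn h + u)%R)^-1 * (h * t u)).
      by rewrite turnM ?addrA -?mulgA ?mulVKg //; apply: (rH SGG).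
    exact: (subgroupM gN).
  - split=> [|u]; first exact: (subgroupV gS).
    have -> : (t (turn g^-1%g + u)%R)^-1 * (g^-1 * t u) =
       ((t (turn g + (u - turn g))%R)^-1 * (g * t (u - turn g)%R))^-1.
      rewrite turnV; last exact: (rH SGG).
      by rewrite [(u - _)%R]addrC addrA subrr add0r !invgM invgK mulgA.
    exact: (subgroupV gN).
apply: generated_min; first exact: subgroup_stab.
move=> _ [s Ss [u _ <-]]; split.
  have Su v : generated S (t v) by case: (tP v).
  apply: (subgroupM gS); first exact: (subgroupV gS).
  by apply: (subgroupM gS) => //; apply: sub_generated.
have Rs : rigid s by exact: (rH SG).
rewrite turnM ?turnM ?turnV //; [|exact: rigidV|exact: rigidM].
by rewrite !(proj2 (tP _)) addNr.
Qed.

(** The sections of the Schreier generators at z; the section of s is taken at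
    the letter that t u reaches from z. *)
Lemma secgrp_generated z S (t : F -> tree_aut p) : S `<=` G -> 
  t 0%R = 1 -> (forall u, generated S (t u) /\ turn (t u) = u) ->
  secgrp z (generated S) =
  generated [set (sec z (t (turn s + u)%R))^-1 *
                 (sec (z + u)%R s * sec z (t u)) | s in S & u in setT].
Proof.
move=> SG t0 tP; have SGG : generated S `<=` G by apply: generated_min.
rewrite /secgrp (schreier SG t0 tP) generated_image; last first.
  rewrite -(schreier SG t0 tP) => x y _ [Sy y0]; apply: sec_stabM => //.
  exact: SGG.
congr generated.
have secE s u : S s -> sec z ((t (turn s + u)%R)^-1 * (s * t u)) =
    (sec z (t (turn s + u)%R))^-1 * (sec (z + u)%R s * sec z (t u)).
  move=> Ss.
  have Rt v : rigid (t v) by apply: (rH SGG); case: (tP v).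
  have Rs : rigid s by exact: (rH SG).
  have Rst : rigid (s * t u) by apply: rigidM.
  rewrite secM // turnM // secV // secM // !(proj2 (tP _)).
  by rewrite addrK.
apply/seteqP; split=> [_ [_ [s Ss [u _ <-]] <-]|_ [s Ss [u _ <-]]].
  by exists s => //; exists u; rewrite ?secE.
exists ((t (turn s + u)%R)^-1 * (s * t u)); last exact: secE.
by exists s => //; exists u.
Qed.

Lemma secgrp_stab z S : S `<=` G -> (forall s, S s -> turn s = 0%R) ->
  secgrp z (generated S) = generated [set sec z s | s in S].
Proof.
move=> SG S0; have SGG : generated S `<=` G by apply: generated_min.
have S0G : generated S `<=` stab (generated S).
  apply: generated_min; last by move=> s Ss; split;
    [apply: sub_generated|apply: S0].
  by apply: subgroup_stab => //; apply: subgroup_generated.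
rewrite -generated_image.
  by rewrite /secgrp; congr image; apply/seteqP; split=> // x [].
by move=> x y _ /S0G[Sy y0]; apply: sec_stabM => //; apply: SGG.
Qed.

Lemma syl_secX h l : G h -> (forall z, syl (l z) (sec z h)) -> forall n z,
  syl (\sum_(i < n) l (z + i%:R * turn h)%R) (sec z (h ^+ n)).
Proof.
move=> Gh Sl; elim=> [|n IHn] z.
  by rewrite big_ord0 expg0 sec1 -(fpow0 p a); exists 0%R.
rewrite big_ord_recr /= addnC expgS secM; last exact: rG (subgroupX n gG Gh).
by rewrite turnX; [apply: sylM | apply: rG].
Qed.

Lemma syl_sec_expp h n z : turn h != 0%R -> syl n h -> syl n (sec z (h ^+ p)).
Proof.
move=> h0 Sh; have [l [lr Sl]] := syl_weights pr_p Sh.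
apply: (syl_le lr); rewrite -(big_orbit_Fp _ l z pr_p h0).
exact: (syl_secX (syl_GGS Sh) Sl).
Qed.

(** Going round the cycle of h from z, the powers h^k and h^(k - p) reach the
    same letter by complementary arcs, whose lengths add up to at most r. *)
Lemma syl_path h r z k : syl r h -> turn h != 0%R ->
  exists2 t, (t = h ^+ (k : F) \/ t = h ^- (p - (k : F))%N) &
             syl r./2 (sec z t).
Proof.
move=> Sh h0; have [l [lr Sl]] := syl_weights pr_p Sh.
have Gh := syl_GGS Sh; have Rh := rG Gh.
have RX n : rigid (h ^+ n) := rG (subgroupX n gG Gh).
(* n1 and n2 are the lengths of the two arcs. *)
pose n1 := (\sum_(0 <= i < (k : nat)) l (z + i%:R * turn h)%R)%N.
pose n2 := (\sum_((k : nat) <= i < p) l (z + i%:R * turn h)%R)%N.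
have lt_kp : (k < p)%N by exact: ltn_Fp.
have n12 : (n1 + n2 <= r)%N.
  rewrite -big_cat_nat ?(ltnW lt_kp) //= big_mkord.
  by rewrite (big_orbit_Fp _ l z pr_p h0).
have [le_n1|lt_n1] := leqP n1 r./2.
  exists (h ^+ k); first by left.
  by apply: (syl_le le_n1); rewrite /n1 big_mkord; exact: (syl_secX Gh Sl).
exists (h ^- (p - k)); first by right.
rewrite secV // turnX //; apply: sylV => //; set y := (z - _)%R.
have le_n2 : (n2 <= r./2)%N by lia.
apply: (syl_le le_n2); rewrite /n2 -{1}[k : nat]add0n big_addn big_mkord.
have -> : (\sum_(i < p - k) l (z + (i + k)%:R * turn h))%R =
     (\sum_(i < p - k) l (y + i%:R * turn h))%R.
  apply: eq_bigr => i _; congr (l _); rewrite /y natrB ?(ltnW lt_kp) //.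
  by rewrite pchar_Fp_0 // natrD; ring.
exact: (syl_secX Gh Sl).
Qed.

Lemma short_transversal H h r z : subgroup H -> H h -> syl r h ->
  turn h != 0%R ->
  exists t : F -> tree_aut p, t 0%R = 1 /\
    forall u, [/\ H (t u), turn (t u) = u & syl r./2 (sec z (t u))].
Proof.
move=> gH Hh Sh h0; have Rh := rG (syl_GGS Sh).
have RX n : rigid (h ^+ n) := subgroupX n (@subgroup_rigid _ pr_p) Rh.
suff /choice[t tP] : forall u, exists t, (u = 0%R -> t = 1) /\
    [/\ H t, turn t = u & syl r./2 (sec z t)].
  by exists t; split=> [|u]; [case: (tP 0%R) => -> | case: (tP u)].
move=> u; have [->|u0] := eqVneq u 0%R.
  exists 1; split=> //; split; [exact: subgroup1 | exact: turn1 |].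
  by rewrite sec1 -(fpow0 p a); apply: syl_a.
have [t tE St] := syl_path z (u / turn h)%R Sh h0.
exists t; split; first by move/eqP: u0.
split=> //; case: tE => ->; first exact: subgroupX.
- by apply: (subgroupV gH); apply: subgroupX.
- by rewrite turnX // natr_Zp mulfVK.
- rewrite turnV // turnX // natrB ?pchar_Fp_0 ?natr_Zp // ?sub0r ?mulNr ?opprK
  ?mulfVK //.
  by rewrite ltnW // ltn_Fp.
Qed.

Definition syl_generated n H :=
  exists S, [/\ finite_set S, S `<=` syl n & H = generated S].

Lemma syl_generated_sub n H : syl_generated n H -> subgroup H /\ H `<=` G.
Proof.
case=> S [_ Sn ->]; split; first exact: subgroup_generated.
by apply: generated_min => // s /Sn /syl_GGS.
Qed.

Lemma syl_generated_le m n H : (m <= n)%N -> syl_generated m H ->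
  syl_generated n H.
Proof.
move=> le_mn [S [finS Sm defH]]; exists S; split=> // s /Sm; exact: syl_le.
Qed.

Lemma finitely_generated_syl H : H `<=` G -> finitely_generated H ->
  exists n, syl_generated n H.
Proof.
move=> HG [S finS defH]; have SG : S `<=` G.
  by apply: subset_trans HG; rewrite defH; apply: sub_generated.
suff [n Sn] : exists n, S `<=` syl n by exists n, S.
move: finS SG; clear defH => /finite_seqP[s ->]; elim: s => [|x s IHs] sG.
  by exists 0%N.
have [|n sn] := IHs; first by move=> y ys; apply: sG; rewrite /= inE ys orbT.
have [|m xm] := @GGS_syl p e pr_p x; first by apply: sG; rewrite /= inE eqxx.
exists (maxn m n) => y /=; rewrite inE => /orP[/eqP->|/sn].
  exact: (syl_le (leq_maxl _ _)).
exact: (syl_le (leq_maxr _ _)).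
Qed.

Lemma syl_generated_fg n H : syl_generated n H -> finitely_generated H.
Proof. by case=> S [finS _ ->]; exists S. Qed.

Lemma secgrp_syl_stab n z H : syl_generated n H ->
  (forall h, H h -> turn h = 0%R) -> syl_generated (uphalf n) (secgrp z H).
Proof.
move=> [S [finS Sn ->]] H0; exists [set sec z s | s in S].
split; first exact: finite_image.
  by move=> _ [s Ss <-]; apply: syl_sec; apply: Sn.
apply: secgrp_stab => s Ss; first exact: (syl_GGS (Sn _ Ss)).
by apply: H0; apply: sub_generated.
Qed.

(** A Schreier generator goes out along an arc of the cycle of h, crosses one
    generator, and comes back along another arc. *)
Lemma secgrp_syl_nonstab n r z H h : syl_generated n H ->
  H h -> syl r h -> turn h != 0%R ->
  syl_generated (r./2 + (uphalf n + r./2)) (secgrp z H).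
Proof.
move=> [S [finS Sn ->]] Hh Sh h0.
have SG : S `<=` G by move=> s /Sn /syl_GGS.
have [t [t0 tP]] := short_transversal z (subgroup_generated S) Hh Sh h0.
eexists; split; last first.
- by apply: secgrp_generated t0 _ => // u; case: (tP u).
- move=> _ [s Ss [u _ <-]]; apply: (sylM pr_p); last apply: (sylM pr_p).
  + by apply: (sylV pr_p); case: (tP (turn s + u)%R).
  + by apply: syl_sec; apply: Sn.
  + by case: (tP u).
rewrite image2E; apply: finite_image; apply: finite_setX => //.
exact: finite_finset.
Qed.

Lemma secgrp_fg z H : H `<=` G -> finitely_generated H ->
  exists n, syl_generated n (secgrp z H).
Proof.
move=> HG /(finitely_generated_syl HG)[n Hn].
have [H0|/existsNP[h /not_implyP[Hh /eqP h0]]] :=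
    pselect (forall h, H h -> turn h = 0%R).
  by eexists; apply: secgrp_syl_stab Hn H0.
have [r Sh] := GGS_syl pr_p (HG _ Hh).
by eexists; apply: secgrp_syl_nonstab Hn Hh Sh h0.
Qed.

Lemma stab_fg H : subgroup H -> H `<=` G -> finitely_generated H ->
  finitely_generated (stab H).
Proof.
move=> gH HG [S finS defH].
have SG : S `<=` G.
  by apply: subset_trans HG; rewrite defH; apply: sub_generated.
have [H0|/existsNP[h /not_implyP[Hh /eqP h0]]] :=
    pselect (forall h, H h -> turn h = 0%R).
  suff -> : stab H = H by exists S.
  by apply/seteqP; split=> [h []|h Hh] //; split=> //; apply: H0.
have [r Sh] := GGS_syl pr_p (HG _ Hh).
have [t [t0 tP]] := short_transversal 0%R gH Hh Sh h0.
eexists; last first.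
  rewrite defH; apply: schreier t0 _ => // u.
  by rewrite -defH; case: (tP u).
rewrite image2E; apply: finite_image; apply: finite_setX => //.
exact: finite_finset.
Qed.

Lemma stab_finite_index H : subgroup H -> H `<=` G -> finite_index (stab H) H.
Proof.
move=> gH HG.
apply: (@sub_finite_set _ _ [set [set y | H y /\ turn y = u] | u in setT]);
  last first.
  by apply: finite_image; exact: finite_finset.
move=> _ [x Hx <-]; exists (turn x) => //.
have Rx := rG (HG _ Hx).
apply/seteqP; split=> [y [Hy yx]|_ [h [Hh h0] <-]]; last first.
  split; first exact: (subgroupM gH).
  by rewrite turnM ?h0 ?addr0 //; apply: (rH HG).
exists (x^-1 * y); last by rewrite mulgA mulgV mul1g.
split; first by apply: (subgroupM gH) => //; apply: (subgroupV gH).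
rewrite turnM ?turnV ?yx ?addNr //; first exact: rigidV.
exact: (rH HG).
Qed.

Lemma stab_level1P H : H `<=` G -> stab H `<=` stab_level1 G.
Proof.
move=> HG h [Hh h0]; split; first exact: HG.
move=> [|x []] // _; rewrite -[x](positionK pr_p) (rG (HG _ Hh)) h0.
by rewrite addr0.
Qed.

End SectionSubgroups.

(** * Subgroups whose conjugates lie in an inductive class *)

Section ConjugationClosedClass.
Variables (p : nat) (e : 'rV['F_p]_p.-1).
Hypothesis pr_p : prime p.
Let F := 'F_p.
Local Notation G := (GGS e).
Local Notation turn := (turn pr_p).
Local Notation secgrp := (secgrp pr_p).
Local Notation stab := (stab pr_p).
Variable X : set (set (tree_aut p)).
Hypothesis indX : inductive_class G X.
Implicit Types (z w : F) (g h t : tree_aut p) (H S : set (tree_aut p)).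

Let gG : subgroup G := @subgroup_GGS p e.

(** An inductive class need not be closed under conjugation, but the sections
    of a subgroup at different letters are only conjugate in G; the subgroups
    all of whose conjugates are in the class form an inductive class in which
    they can be exchanged. *)
Definition conjugates_in H := forall g, G g -> X [set x ^ g | x in H].

Lemma conjugates_in_id H : conjugates_in H -> X H.
Proof. by move=> /(_ 1 (subgroup1 gG)); rewrite conj_set1. Qed.

Lemma conjugates_inJ H g :
  G g -> conjugates_in H -> conjugates_in [set x ^ g | x in H].
Proof.
by move=> Gg XH h Gh; rewrite conj_setM; apply: XH; apply: (subgroupM gG).
Qed.

Lemma conjugates_inJV H g :
  G g -> conjugates_in [set x ^ g | x in H] -> conjugates_in H.
Proof.
move=> Gg /(conjugates_inJ (subgroupV gG Gg)).
by rewrite conj_setM mulgV conj_set1.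
Qed.

Lemma conjugates_in_full : conjugates_in G.
Proof. by move=> g Gg; rewrite conj_set_id //; apply: inductive_full indX. Qed.

Lemma conjugates_in_finite H : subgroup H -> H `<=` G -> finite_set H ->
  conjugates_in H.
Proof.
move=> gH HG finH g Gg.
apply: (inductive_finite_index indX) (inductive_triv indX).
- exact: subgroup_trivial.
- exact: subgroup_conj.
- move=> _ ->; exists 1; [exact: subgroup1 | exact: conj1g].
- exact: (conj_sub gG).
- by apply: finite_image; apply: finite_image.
Qed.

(** The stabiliser of the first level has finite index, so its sections
    decide. *)
Lemma inductive_secgrp H : subgroup H -> H `<=` G -> finitely_generated H ->
  (forall z, X (secgrp z H)) -> X H.
Proof.
move=> gH HG fgH XH.
have gS : subgroup (stab H) := subgroup_stab pr_p gH HG.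
have SH : stab H `<=` H by move=> x [].
apply: (inductive_finite_index indX gS gH SH HG).
  exact: (stab_finite_index pr_p gH HG).
apply: (inductive_sections indX gS).
- exact: stab_level1P.
- exact: (stab_fg pr_p gH HG).
move=> [|x []] // _; suff -> : section_image [:: x] (stab H) =
  secgrp (position x) H.
  exact: XH.
by rewrite /secgrp /sec positionK.
Qed.

Lemma conjugates_in_secgrp H : subgroup H -> H `<=` G -> finitely_generated H ->
  (forall z, conjugates_in (secgrp z H)) -> conjugates_in H.
Proof.
move=> gH HG fgH XH g Gg.
apply: inductive_secgrp => [|||z]; first exact: subgroup_conj.
- exact: (conj_sub gG).
- by apply: finitely_generated_image => // x y _ _; rewrite conjMg.
by rewrite (secgrp_conj pr_p z gH HG Gg); apply: XH; apply: GGS_sec.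
Qed.

(** When H is transitive on the letters, all its sections are conjugate. *)
Lemma conjugates_in_secgrp1 H h w : subgroup H -> H `<=` G ->
  finitely_generated H ->
  H h -> turn h != 0%R -> conjugates_in (secgrp w H) -> conjugates_in H.
Proof.
move=> gH HG fgH Hh h0 XH; apply: conjugates_in_secgrp => // z.
have [g Gg ->] := secgrp_conj_in z w gH HG Hh h0.
exact: conjugates_inJ.
Qed.

End ConjugationClosedClass.

(** * Subgroups that map onto the abelianization *)

Section DenseSubgroups.
Variables (p : nat) (e : 'rV['F_p]_p.-1).
Hypotheses (pr_p : prime p) (e_neq0 : e != 0%R).
Let F := 'F_p.
Local Notation a := (ggs_a p).
Local Notation b := (ggs_b e).
Local Notation G := (GGS e).
Local Notation sec := (sec pr_p).
Local Notation turn := (turn pr_p).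
Local Notation rigid := (rigid pr_p).
Local Notation secgrp := (secgrp pr_p).
Local Notation stab := (stab pr_p).
Local Notation bdeg := (bdeg pr_p e_neq0).
Local Notation E := (exponent e pr_p).
Local Notation syl := (syl e).
Hypothesis sumE : (\sum_z E z = 0)%R.
Implicit Types (z w : F) (g h t : tree_aut p) (H M S : set (tree_aut p)).

Let gG : subgroup G := @subgroup_GGS p e.
Let rH H g : H `<=` G -> H g -> rigid g.
Proof. by move=> HG Hg; exact: (GGS_rigid pr_p (HG _ Hg)). Qed.

(** The images of the two elements under (turn, bdeg) are independent, so this
    is surjectivity onto F_p^2. *)
Definition onto H := (exists2 g, H g & turn g != 0%R) /\
                     (exists2 h, stab H h & bdeg h != 0%R).

Lemma turnJG g h : G g -> G h -> turn (g ^ h) = turn g.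
Proof. by move=> Gg Gh; apply: turnJ; apply: (@GGS_rigid p e pr_p). Qed.

Lemma bdegJ g h : G g -> G h -> bdeg (g ^ h) = bdeg g.
Proof.
move=> Gg Gh; rewrite conjgE !bdegM ?bdegV //; first by rewrite addrC addrK.
- exact: (subgroupV gG).
- exact: (subgroupM gG).
Qed.

Lemma secgrp_realizes z v M h s : subgroup M -> M `<=` G ->
  M h -> turn h != 0%R -> stab M s ->
  exists k,
    [/\ secgrp z M k, turn k = turn (sec v s) & bdeg k = bdeg (sec v s)].
Proof.
move=> gM MG Mh h0 [Ms s0].
have [g Gg defM] := secgrp_conj_in z v gM MG Mh h0.
have Gsv : G (sec v s) by apply: GGS_sec; exact: MG.
exists (sec v s ^ g); rewrite turnJG ?bdegJ //; split=> //.
by rewrite defM; exists (sec v s) => //; exists s.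
Qed.

(** If the image of K were a line, it would be the graph of a linear function
    of the turn, because some turn is nonzero.  The b-degrees B of the
    sections of s would then satisfy B = j E * B, hence vanish, and so would
    their turns. *)
Lemma onto_spans K s : subgroup K -> K `<=` G -> G s ->
  (forall v, exists k,
     [/\ K k, turn k = turn (sec v s) & bdeg k = bdeg (sec v s)]) ->
  (exists v, turn (sec v s) != 0%R) -> onto K.
Proof.
move=> gK KG Gs Ks [v sv].
have [g [Kg gv _]] := Ks v.
have g0 : turn g != 0%R by rewrite gv.
split; first by exists g.
apply: contrapT => noh.
(* Divide k by the power of g of the same turn. *)
have lin k : K k -> bdeg k = (bdeg g / turn g * turn k)%R.
  move=> Kk; pose n : F := (turn k / turn g)%R.
  have Kgn : K (g ^+ n) := subgroupX n gK Kg.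
  pose h := k * (g ^+ n)^-1.
  have Kh : K h by apply: (subgroupM gK) => //; apply: (subgroupV gK).
  have Gn := KG _ Kgn; have GnV := subgroupV gG Gn; have Rn := rH KG Kgn.
  have bh0 : bdeg h = 0%R.
    apply/eqP; apply: contra_notT noh => bh; exists h => //; split=> //.
    rewrite turnM ?turnV ?turnX //; last by exact: rigidV.
    - by rewrite natr_Zp mulfVK // subrr.
    - exact: (rH KG Kg).
    - exact: (rH KG Kk).
  move/eqP: bh0; rewrite bdegM ?bdegV ?bdegX //; try exact: KG.
  by rewrite natr_Zp subr_eq0 => /eqP->; rewrite /n mulrC mulrA mulrAC.
have c0 z : bdeg (sec z s) = 0%R.
  move: z; apply: (conv_eigen pr_p sumE (j := (bdeg g / turn g)%R)) => z.
  have [k [Kk kt kb]] := Ks z.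
  by rewrite -(turn_sec pr_p e_neq0 z Gs) -kb -kt; apply: lin.
case/negP: sv; rewrite (turn_sec pr_p e_neq0 v Gs) /conv big1 // => i _.
by rewrite c0 mul0r.
Qed.

(** The b-degrees of the sections of s have a nonzero sum, so that they form a
    unit of F_p[Z/p] and their convolution with E, the vector of turns, is
    nonzero. *)
Lemma onto_secgrp z M : subgroup M -> M `<=` G -> onto M -> onto (secgrp z M).
Proof.
move=> gM MG [[h Mh h0] [s Ms bs]].
have Gs : G s by apply: MG; case: Ms.
apply: (@onto_spans _ s) => //; first exact: (subgroup_secgrp pr_p _ gM MG).
- exact: secgrp_sub.
- by move=> v; exact: (secgrp_realizes z v gM MG Mh h0 Ms).
have [|v sv] := conv_neq0 pr_p (exponent_neq0 pr_p e_neq0) (c := fun z =>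
  bdeg (sec z s)).
  by rewrite sum_bdeg_sec.
by exists v; rewrite (turn_sec pr_p e_neq0 v Gs).
Qed.

(** One section of nonzero turn makes the image of (turn, bdeg) on the
    sections the whole plane: two consecutive subgroups in a chain of sections
    cannot both move the first level unless the second one is onto. *)
Lemma secgrp_stab_or_onto z M h : subgroup M -> M `<=` G -> M h ->
  turn h != 0%R ->
  (forall k, secgrp z M k -> turn k = 0%R) \/ onto (secgrp z M).
Proof.
move=> gM MG Mh h0.
have [M0|/existsNP[k /not_implyP[[s Ms <-] /eqP s0]]] :=
  pselect (forall k, secgrp z M k -> turn k = 0%R); first by left.
have Gs : G s by apply: MG; case: Ms.
right; apply: (@onto_spans _ s) => //;
  first exact: (subgroup_secgrp pr_p _ gM MG).
- exact: secgrp_sub.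
- by move=> v; exact: (secgrp_realizes z v gM MG Mh h0 Ms).
by exists z.
Qed.

Lemma full_of_generators M (k x : F) : subgroup M -> M `<=` G ->
  k != 0%R -> x != 0%R -> M (fpow a k) -> M (fpow b x) -> M = G.
Proof.
move=> gM MG k0 x0 Mk Mx; apply/seteqP; split=> //.
apply: GGS_min => //.
  by rewrite -(fpow1 pr_p a);
    exact: (subgroup_fpow pr_p 1%R (expa_p pr_p) gM k0 Mk).
by rewrite -(fpow1 pr_p b);
  exact: (subgroup_fpow pr_p 1%R (expb_p e pr_p) gM x0 Mx).
Qed.

(** As the sum of E is zero, E cannot be supported at one letter.  The freedom
    to avoid a letter is what makes the next descent strict. *)
Lemma exponent_neq0_off v : exists u, E u != 0%R /\ u != v.
Proof.
apply: contrapT => /forallNP Ev.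
have E0 u : u != v -> E u = 0%R.
  by move=> uv; apply/eqP; apply: contra_notT (Ev u).
have [u Eu] := exponent_neq0 pr_p e_neq0; have := sumE.
rewrite (bigD1 v) //= big1 ?addr0 // => Ev0.
by case: (eqVneq u v) Eu => [->|/E0->]; rewrite ?Ev0 eqxx.
Qed.

Lemma exponent_nz u : E u != 0%R -> u != 0%R.
Proof. by apply: contra_neq => ->; rewrite exponent0. Qed.

Lemma secgrp0_b M : M b -> secgrp 0%R M b.
Proof.
move=> Mb; exists b; first by split=> //; apply: turn_b.
by rewrite sec_b eqxx.
Qed.

(** The section of b^g at 0 is conjugate to that of b at the letter reached by
    g: this is how powers of a enter the section of M at 0. *)
Lemma secgrp0_conj_a M g : subgroup M -> M `<=` G -> M b -> M g ->
  turn g != 0%R -> secgrp 0%R M (fpow a (E (turn g)) ^ sec 0%R g).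
Proof.
move=> gM MG Mb Mg g0.
have Rg := rH MG Mg; have Rb := rigid_b e pr_p.
exists (b ^ g).
  by split; [apply: subgroupJ | rewrite turnJ // turn_b].
by rewrite sec_stabJ ?turn_b // add0r sec_b (negPf g0).
Qed.

Section InductiveClass.
Variable X : set (set (tree_aut p)).
Hypothesis indX : inductive_class G X.
Local Notation conjugates_in := (conjugates_in e X).

(** Put a_t = t^-1 a t.  The power of a_t of turn u conjugates b to an element
    whose section at 0 is a^(E u) conjugated by t_u^-1 t_0, where t_z is the
    section of t at z.  Since the lengths of the t_z add up to at most r, and
    two letters u with E u nonzero are available, t_u^-1 t_0 can be made
    shorter than t. *)
Lemma conjugates_in_of_conj_a r M t (k : F) : subgroup M -> M `<=` G ->
  finitely_generated M -> M b -> k != 0%R -> syl r t -> M (fpow a k ^ t) ->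
  conjugates_in M.
Proof.
elim/ltn_ind: r M t k => r IHr M t k gM MG fgM Mb k0 St Mk.
have M_full : M (fpow a k) -> conjugates_in M.
  move=> Ma; rewrite (@full_of_generators M k 1%R) ?oner_neq0 ?(fpow1 pr_p) //.
  exact: conjugates_in_full.
have Gt := syl_GGS St; have Rt := GGS_rigid pr_p Gt.
have Ra (x : F) : rigid (fpow a x).
  by apply: (@GGS_rigid p e pr_p); apply: GGS_fpow_a.
have turn_at (x : F) : turn (fpow a x ^ t) = x by rewrite turnJ // turn_fpow_a.
have M_a (x : F) : M (fpow a x ^ t).
  rewrite -fpowJ; apply: (subgroup_fpow pr_p _ _ gM k0).
    by rewrite -conjXg expa_p // conj1g.
  by rewrite fpowJ.
have sec_at (x : F) : sec 0%R (fpow a x ^ t) = (sec x t)^-1 * sec 0%R t.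
  have Rat : rigid (fpow a x * t) by apply: rigidM.
  rewrite conjgE secM // secM // secV // turnM // sec_fpow_a turn_fpow_a.
  by rewrite mul1g add0r addrK.
have step u m : E u != 0%R -> syl m ((sec u t)^-1 * sec 0%R t) -> (m < r)%N ->
    conjugates_in M.
  move=> Eu Su lt_mr.
  apply: (conjugates_in_secgrp1 indX (w := 0%R) gM MG fgM Mk);
    first by rewrite turn_at.
  have u0 := exponent_nz Eu.
  have [n Mn] := secgrp_fg pr_p 0%R MG fgM.
  apply: (IHr m lt_mr (secgrp 0%R M) _ (E u)) Su _ => //.
  - exact: (subgroup_secgrp pr_p _ gM MG).
  - exact: secgrp_sub.
  - exact: syl_generated_fg Mn.
  - exact: secgrp0_b.
  by have := secgrp0_conj_a gM MG Mb (M_a u); rewrite turn_at sec_at; apply.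
have [u1 Eu1] := exponent_neq0 pr_p e_neq0.
have [u2 [Eu2 u21]] := exponent_neq0_off u1.
have u10 := exponent_nz Eu1; have u20 := exponent_nz Eu2.
case: r IHr St step => [|[|r]] _ St step.
- case: St => x tx; apply: M_full; move: Mk; rewrite tx.
  by rewrite (fpow_conj pr_p) ?expa_p.
- have [_ [x [y [[v ->] tE]]]] := St.
  have sec_t u : (u + y != 0)%R -> syl 0 (sec u t).
    move=> /negPf uy; rewrite tE secM; last first.
      apply: (@GGS_rigid p e pr_p); apply: (subgroupM gG).
        exact: GGS_fpow_b.
      exact: GGS_fpow_a.
    rewrite sec_fpow_a mul1g sec_syllable sec_fpow_b uy; exact: syl_a.
  (* The syllable of t is seen only by the section at - y.  If y = 0, conjugating
     by t amounts to conjugating by a power of b, which is in M; otherwise t_0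
     and t_u, for u different from - y, have no syllable. *)
  have [y0|y0] := eqVneq y 0%R.
    apply: M_full; move: Mk; rewrite tE y0 fpow0 mulg1 conjgM.
    have -> : fpow a k ^ fpow a v = fpow a k.
      by rewrite (fpow_conj pr_p) ?expa_p.
    move=> Mkx; rewrite -[fpow a k](conjgK (fpow b x)); apply: subgroupJ => //.
    by apply: (subgroupV gM); apply: subgroupX.
  have [u [Eu uy]] := exponent_neq0_off (- y)%R.
  apply: (step u 0%N) => //; apply: (@sylM _ _ pr_p 0 0).
    by apply: (sylV pr_p); apply: sec_t; rewrite addr_eq0.
  by apply: sec_t; rewrite add0r.
have [l [l_le Sl]] := syl_weights pr_p St.
have l3 : (l 0%R + l u1 + l u2 <= r.+2)%N.
  apply: leq_trans l_le; rewrite (bigD1 0%R) //= (bigD1 u1) //=.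
  by rewrite (bigD1 u2) ?u20 //= !addnA leq_addr.
(* If u1 does not shorten t, then all the syllables of t are in its sections at
   0 and u1, so t has no syllable at u2. *)
have [lt1|ge1] := ltnP (l u1 + l 0%R) r.+2.
  by apply: step Eu1 _ lt1; apply: (sylM pr_p) => //; apply: (sylV pr_p).
have l2 : l u2 = 0%N by lia.
have S0 : syl (uphalf r.+2) (sec 0%R t) by apply: syl_sec.
apply: (step u2 (l u2 + uphalf r.+2)%N) => //.
  by apply: (sylM pr_p) => //; apply: (sylV pr_p).
by rewrite l2 add0n; lia.
Qed.

(** A conjugate of b has a conjugate of a power of a as section at 0. *)
Lemma conjugates_in_of_b M h : subgroup M -> M `<=` G -> finitely_generated M ->
  M b -> M h -> turn h != 0%R -> conjugates_in M.
Proof.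
move=> gM MG fgM Mb Mh h0.
apply: (conjugates_in_secgrp1 indX (w := 0%R) gM MG fgM Mh h0).
have [u Eu] := exponent_neq0 pr_p e_neq0; have u0 := exponent_nz Eu.
pose g := h ^+ (u / turn h : F)%R.
have Mg : M g by apply: subgroupX.
have tg : turn g = u.
  by rewrite turnX ?natr_Zp ?mulfVK //; apply: (rH MG).
have [n Mn] := secgrp_fg pr_p 0%R MG fgM.
have [r Sr] : exists r, syl r (sec 0%R g).
  by apply: (GGS_syl pr_p); apply: GGS_sec; exact: MG.
apply: (conjugates_in_of_conj_a _ _ (syl_generated_fg Mn) _ Eu Sr).
- exact: (subgroup_secgrp pr_p _ gM MG).
- exact: secgrp_sub.
- exact: secgrp0_b.
by rewrite -tg; apply: secgrp0_conj_a => //; rewrite tg.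
Qed.

(** Some section k of g has nonzero b-degree and at most half of the
    syllables, rounded up.  If k has turn 0 it is the next element of the
    descent; otherwise a section of k^p is, since it has the b-degree of k,
    the turn 0 (the sum of E being zero) and no more syllables than k. *)
Lemma conjugates_in_of_stab_bdeg n M g : subgroup M -> M `<=` G ->
  finitely_generated M -> onto M -> stab M g -> syl n g -> bdeg g != 0%R ->
  conjugates_in M.
Proof.
elim/ltn_ind: n M g => -[|[|n]] IHn M g gM MG fgM ontoM [Mg g0] Sg bg.
- by case: Sg bg => x ->; rewrite bdeg_fpow_a eqxx.
- case: Sg => _ [x [y [[v ->] gE]]].
  have Rab (u w : F) : rigid (fpow b u * fpow a w).
    apply: (@GGS_rigid p e pr_p); apply: (subgroupM gG).
      exact: GGS_fpow_b.
    exact: GGS_fpow_a.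
  have Ra (u : F) : rigid (fpow a u).
    by apply: (@GGS_rigid p e pr_p); apply: GGS_fpow_a.
  have Rb (u : F) : rigid (fpow b u).
    by apply: (@GGS_rigid p e pr_p); apply: GGS_fpow_b.
  have vy : v = (- y)%R.
    move: g0; rewrite gE !turnM // !turn_fpow_a turn_fpow_b add0r => /eqP.
    by rewrite addr_eq0 => /eqP.
  have gJ : g = fpow b x ^ fpow a y.
    by rewrite gE vy (fpowN pr_p) ?expa_p // conjgE.
  have x0 : x != 0%R.
    apply: contra_neq bg => x0; rewrite gJ x0 fpow0 conj1g; exact: bdeg1.
  pose t : tree_aut p := fpow a (- y)%R.
  have Gt : G t by exact: GGS_fpow_a.
  apply: (conjugates_inJV Gt).
  have [[h Mh h0] _] := ontoM.
  have gMt := subgroup_conj t gM; have MtG := conj_sub gG Gt MG.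
  apply: (@conjugates_in_of_b _ (h ^ t)) => //.
  - by apply: finitely_generated_image => // u w _ _; rewrite conjMg.
  - have : [set u ^ t | u in M] (fpow b x).
      exists g => //; rewrite gJ /t (fpowN pr_p) ?expa_p //; exact: conjgK.
    move/(subgroup_fpow pr_p 1%R (expb_p e pr_p) gMt x0).
    by rewrite (fpow1 pr_p).
  - by exists h.
  - by rewrite turnJG //; apply: MG.
have Gg := MG _ Mg.
have [u bu] : exists u, bdeg (sec u g) != 0%R.
  apply: contrapT => /forallNP b0; case/negP: bg.
  rewrite -(sum_bdeg_sec pr_p e_neq0 Gg) big1 // => u _.
  by apply/eqP; apply: contra_notT (b0 u).
have [[h Mh h0] _] := ontoM.
have lt_n : (uphalf n.+2 < n.+2)%N by lia.
have gK := subgroup_secgrp pr_p u gM MG; have KG := secgrp_sub (pr_p :=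
  pr_p) (z := u) MG.
have [m Km] := secgrp_fg pr_p u MG fgM; have fgK := syl_generated_fg Km.
have Kk : secgrp u M (sec u g) by exists g.
have Sk : syl (uphalf n.+2) (sec u g) by apply: syl_sec.
have ontoK := onto_secgrp u gM MG ontoM.
apply: (conjugates_in_secgrp1 indX (w := u) gM MG fgM Mh h0).
have [k0|k0] := eqVneq (turn (sec u g)) 0%R.
  by apply: (IHn _ lt_n _ (sec u g)).
apply: (conjugates_in_secgrp1 indX (w := 0%R) gK KG fgK Kk k0).
have [m' Km'] := secgrp_fg pr_p 0%R KG fgK.
have Gk := KG _ Kk; have Rk := rH KG Kk.
pose k := sec u g; pose s := sec 0%R (k ^+ p).
apply: (IHn _ lt_n _ s) => //.
- exact: (subgroup_secgrp pr_p _ gK KG).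
- exact: secgrp_sub.
- exact: syl_generated_fg Km'.
- exact: onto_secgrp.
- split; last by rewrite (turn_sec_expp e_neq0) // sumE mulr0.
  exists (k ^+ p) => //; split; first exact: subgroupX.
  by rewrite turnX // pchar_Fp_0 // mul0r.
- exact: syl_sec_expp.
- by rewrite bdeg_sec_expp.
Qed.

Lemma conjugates_in_onto M : subgroup M -> M `<=` G -> finitely_generated M ->
  onto M -> conjugates_in M.
Proof.
move=> gM MG fgM ontoM; have [_ [h Mh bh]] := ontoM.
have [n Sh] : exists n, syl n h by apply: (GGS_syl pr_p); apply: MG; case: Mh.
exact: conjugates_in_of_stab_bdeg ontoM Mh Sh bh.
Qed.

End InductiveClass.

End DenseSubgroups.

(** * The induction on the length of generators *)

Section SubgroupInduction.
Variables (p : nat) (e : 'rV['F_p]_p.-1).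
Hypotheses (pr_p : prime p) (e_neq0 : e != 0%R).
Let F := 'F_p.
Local Notation a := (ggs_a p).
Local Notation b := (ggs_b e).
Local Notation G := (GGS e).
Local Notation sec := (sec pr_p).
Local Notation turn := (turn pr_p).
Local Notation secgrp := (secgrp pr_p).
Local Notation stab := (stab pr_p).
Local Notation bdeg := (bdeg pr_p e_neq0).
Local Notation E := (exponent e pr_p).
Local Notation syl := (syl e).
Local Notation onto := (onto pr_p e_neq0).
Hypothesis sumE : (\sum_z E z = 0)%R.
Variable X : set (set (tree_aut p)).
Hypothesis indX : inductive_class G X.
Local Notation conjugates_in := (conjugates_in e X).
Implicit Types (z w : F) (g h t s : tree_aut p) (H K L M S : set (tree_aut p)).

Let gG : subgroup G := @subgroup_GGS p e.

(** The sections of K are onto or stabilise the first level, and a shorter h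
    gives shorter generators for them. *)
Lemma conjugates_in_nonstab m r K h : syl_generated e m K -> K h -> syl r h ->
  turn h != 0%R ->
  (forall L, syl_generated e (r./2 + (uphalf m + r./2)) L ->
     (forall x, L x -> turn x = 0%R) -> conjugates_in L) ->
  conjugates_in K.
Proof.
move=> Km Kh Sh h0 IH; have [gK KG] := syl_generated_sub Km.
apply: (conjugates_in_secgrp indX gK KG (syl_generated_fg Km)) => z.
have Lm := secgrp_syl_nonstab z Km Kh Sh h0.
have [gL LG] := syl_generated_sub Lm.
have [L0|ontoL] := secgrp_stab_or_onto e_neq0 sumE z gK KG Kh h0.
  exact: IH Lm L0.
exact: (conjugates_in_onto sumE indX gL LG (syl_generated_fg Lm) ontoL).
Qed.

Lemma finite_fpow (g : tree_aut p) : finite_set [set fpow g x | x in [set: F]].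
Proof. by apply: finite_image; exact: finite_finset. Qed.

Lemma subgroup_fpows (g : tree_aut p) : g ^+ p = 1 ->
  subgroup [set fpow g x | x in [set: F]].
Proof.
move=> gp; apply: subgroup_intro => [|_ _ [x _ <-] [y _ <-]|_ [x _ <-]].
- by exists 0%R; rewrite // fpow0.
- by exists (x + y)%R; rewrite // (fpowD pr_p).
- by exists (- x)%R; rewrite // (fpowN pr_p).
Qed.

(** Such a generating set is contained in a cyclic group of order p or
    contains generators of G. *)
Lemma conjugates_in_powers S : finite_set S ->
  (forall s, S s ->
     (exists x : F, s = fpow a x) \/ (exists x : F, s = fpow b x)) ->
  conjugates_in (generated S).
Proof.
move=> finS Sab; have gS := subgroup_generated S.
have SG : generated S `<=` G.
  apply: generated_min => // s /Sab[] [x ->]; first exact: GGS_fpow_a.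
  exact: GGS_fpow_b.
have [[x [x0 Sx]]|nob] := pselect (exists x : F, x != 0%R /\ S (fpow b x)).
  have [[k [k0 Sk]]|noa] := pselect (exists k : F, k != 0%R /\ S (fpow a k)).
    rewrite (full_of_generators pr_p gS SG k0 x0); last 2 first.
    - exact: sub_generated.
    - exact: sub_generated.
    exact: conjugates_in_full.
  apply: (conjugates_in_finite indX gS SG).
  apply: sub_finite_set (finite_fpow b); apply: generated_min.
    exact: (subgroup_fpows (expb_p e pr_p)).
  move=> s Ss; case: (Sab s Ss) => -[k sk]; last by exists k.
  exists 0%R => //; rewrite fpow0 sk; case: (eqVneq k 0%R) => [->|k0].
    by rewrite fpow0.
  by case: noa; exists k; rewrite -sk.
apply: (conjugates_in_finite indX gS SG).
apply: sub_finite_set (finite_fpow a); apply: generated_min.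
  exact: (subgroup_fpows (expa_p pr_p)).
move=> s Ss; case: (Sab s Ss) => -[k sk]; first by exists k.
exists 0%R => //; rewrite fpow0 sk; case: (eqVneq k 0%R) => [->|k0].
  by rewrite fpow0.
by case: nob; exists k; rewrite -sk.
Qed.

Lemma syl1_trivial s : syl 1 s -> turn s = 0%R -> bdeg s = 0%R -> s = 1.
Proof.
move=> [_ [x [y [[v ->] sE]]]] ts bs.
have Gba : G (fpow b x * fpow a y).
  by apply: (subgroupM gG); [exact: GGS_fpow_b | exact: GGS_fpow_a].
have Gav : G (fpow a v) by exact: GGS_fpow_a.
have Gay : G (fpow a y) by exact: GGS_fpow_a.
have Gbx : G (fpow b x) by exact: GGS_fpow_b.
have rG g : G g -> rigid pr_p g := @GGS_rigid p e pr_p g.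
have x0 : x = 0%R.
  by rewrite -bs sE !bdegM // !bdeg_fpow_a bdeg_fpow_b add0r addr0.
have vy : (v + y = 0)%R.
  rewrite -ts sE !turnM ?turn_fpow_a ?turn_fpow_b ?add0r //; by apply: rG.
by rewrite sE x0 fpow0 mul1g -(fpowD pr_p) ?expa_p // vy fpow0.
Qed.

Lemma nonstab_generator K S : K = generated S -> S `<=` G ->
  (exists2 h, K h & turn h != 0%R) -> exists2 s, S s & turn s != 0%R.
Proof.
move=> -> SG [h Kh h0]; apply: contrapT => noS.
have SGG : generated S `<=` G by apply: generated_min.
suff /(_ h Kh)[_ /eqP] :
  generated S `<=` stab (generated S) by rewrite (negPf h0).
apply: generated_min.
  exact: (subgroup_stab pr_p (subgroup_generated S) SGG).
move=> s Ss; split; first exact: sub_generated.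
by apply/eqP; apply: contra_notT noS => s0; exists s.
Qed.

(** Here the Schreier generators of the section K, whose generators have two
    syllables, may again have three syllables, and a better choice is needed.
    If a generator with one syllable moves the first level, it serves as h.
    Otherwise the nontrivial generators are of the form b^x a^k b^y: those
    with one syllable have turn 0, hence b-degree 0 because K is not onto, and
    are trivial.  Conjugating by a power of b then makes one generator of
    nonzero turn lose a syllable, while the others keep at most two. *)
Lemma conjugates_in_three z L h : syl_generated e 3 L ->
  (forall x, L x -> turn x = 0%R) ->
  (forall M, syl_generated e 1 M -> (forall x, M x -> turn x = 0%R) ->
    conjugates_in M) ->
  secgrp z L h -> turn h != 0%R -> conjugates_in (secgrp z L).
Proof.
move=> L3 L0 IH Kh h0; have [gL LG] := syl_generated_sub L3.
have K2 := secgrp_syl_stab z L3 L0; rewrite /= in K2.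
have [gK KG] := syl_generated_sub K2; have fgK := syl_generated_fg K2.
have [S [finS S3 defL]] := L3.
have SG : S `<=` G by move=> s /S3 /syl_GGS.
pose T := [set sec z s | s in S].
have defK : secgrp z L = generated T.
  rewrite defL; apply: secgrp_stab SG _ => s Ss; apply: L0; rewrite defL.
  exact: sub_generated.
have TK : T `<=` secgrp z L by rewrite defK; apply: sub_generated.
have TG : T `<=` G by move=> s /TK /KG.
have [ontoK|not_onto] := pselect (onto (secgrp z L)).
  exact: (conjugates_in_onto sumE indX gK KG fgK ontoK).
have stab_bdeg0 k : secgrp z L k -> turn k = 0%R -> bdeg k = 0%R.
  move=> Kk k0; apply/eqP; apply: contra_notT not_onto => bk.
  by split; [exists h | exists k].
have [h' Th' h'0] : exists2 s, T s & turn s != 0%R.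
  by apply: (nonstab_generator defK TG); exists h.
have [[s [Ts s1 s0]]|no_short] :=
    pselect (exists s, [/\ T s, syl 1 s & turn s != 0%R]).
  by apply: (conjugates_in_nonstab K2 (TK _ Ts) s1 s0) => M; apply: IH.
have long s : T s -> s = 1 \/
    exists x k y : F, s = fpow b x * fpow a k * fpow b y.
  move=> Ts; have [s0 Ss0 defs] := Ts.
  case: (syl_sec3 pr_p z (S3 _ Ss0)) => [s1|]; last by rewrite defs; right.
  left; rewrite defs in s1; have [st0|st0] := eqVneq (turn s) 0%R.
    by apply: syl1_trivial => //; apply: stab_bdeg0 => //; apply: TK.
  by case: no_short; exists s.
have [h'1|[x [k [y defh']]]] := long _ Th'.
  by move: h'0; rewrite h'1 turn1 eqxx.
pose t := (fpow b y)^-1.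
have Gt : G t by apply: (subgroupV gG); apply: GGS_fpow_b.
have bD (u v : F) : fpow b u * fpow b v = fpow b (u + v)%R.
  by rewrite (fpowD pr_p) ?expb_p.
(* The exponent y is that of the last syllable of h'. *)
have long_conj (u v w : F) : (fpow b u * fpow a v * fpow b w) ^ t =
    fpow b (y + u)%R * fpow a v * fpow b (w - y)%R.
  by rewrite conjgE /t invgK -(fpowN pr_p) ?expb_p // -!mulgA bD !mulgA bD.
apply: (conjugates_inJV Gt).
have K'2 : syl_generated e 2 [set u ^ t | u in secgrp z L].
  exists [set u ^ t | u in T]; split.
  - by apply: finite_image; apply: finite_image.
  - move=> _ [s /long[->|[u [v [w ->]]]] <-].
      by rewrite conj1g -(fpow0 p a); apply: syl_a.
    rewrite long_conj; apply: (@sylM _ _ pr_p 1 1); last exact: syl_b.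
    by apply: (@sylM _ _ pr_p 1 0); [exact: syl_b | exact: syl_a].
  by rewrite defK generated_image // => u v _ _; rewrite conjMg.
apply: (conjugates_in_nonstab (r := 1) (h := h' ^ t) K'2).
- by exists h' => //; apply: TK.
- rewrite defh' long_conj subrr fpow0 mulg1.
  by apply: (@sylM _ _ pr_p 1 0); [exact: syl_b | exact: syl_a].
- by rewrite (turnJG pr_p (TG _ Th') Gt).
exact: IH.
Qed.

(** For n at least 2 and other than 3, the Schreier generators for the
    sections of a section K of L have fewer than n syllables. *)
Lemma conjugates_in_stab n L : syl_generated e n L ->
  (forall x, L x -> turn x = 0%R) -> conjugates_in L.
Proof.
elim/ltn_ind: n L => n IHn L Ln L0; have [gL LG] := syl_generated_sub Ln.
apply: (conjugates_in_secgrp indX gL LG (syl_generated_fg Ln)) => z.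
have [n_le1|n_gt1] := leqP n 1.
  have [S [finS S1 defL]] := syl_generated_le n_le1 Ln.
  have SG : S `<=` G by move=> s /S1 /syl_GGS.
  rewrite defL (secgrp_stab _ SG); last first.
    by move=> s Ss; apply: L0; rewrite defL; apply: sub_generated.
  apply: conjugates_in_powers; first exact: finite_image.
  by move=> _ [s /S1 Ss <-]; apply: syl_sec1.
have Km := secgrp_syl_stab z Ln L0.
have [K0|/existsNP[h /not_implyP[Kh /eqP h0]]] :=
    pselect (forall h, secgrp z L h -> turn h = 0%R).
  by apply: IHn Km K0; lia.
have [n3|n3] := eqVneq n 3.
  by rewrite n3 in Ln IHn; apply: (conjugates_in_three Ln L0 _ Kh h0) => M;
    apply: IHn.
have [S [finS Sm defK]] := Km.
have SG : S `<=` G by move=> s /Sm /syl_GGS.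
have [s Ss s0] : exists2 s, S s & turn s != 0%R.
  by apply: (nonstab_generator defK SG); exists h.
apply: (conjugates_in_nonstab Km _ (Sm _ Ss) s0).
  by rewrite defK; apply: sub_generated.
by move=> M; apply: IHn; lia.
Qed.

Lemma conjugates_in_finitely_generated H : subgroup H -> H `<=` G ->
  finitely_generated H -> conjugates_in H.
Proof.
move=> gH HG fgH; have [n Hn] := finitely_generated_syl pr_p HG fgH.
have [H0|/existsNP[h /not_implyP[Hh /eqP h0]]] :=
    pselect (forall h, H h -> turn h = 0%R).
  exact: conjugates_in_stab Hn H0.
have [r Sr] := GGS_syl pr_p (HG _ Hh).
apply: (conjugates_in_nonstab Hn Hh Sr h0) => L; exact: conjugates_in_stab.
Qed.

End SubgroupInduction.

Theorem theorem1p4 (p : nat) (e : 'rV['F_p]_p.-1) :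
  prime p -> odd p -> e != 0%R ->
  torsion (GGS e) -> subgroup_induction_property (GGS e).
Proof.
move=> pr_p _ e_neq0 torG; split=> [|X indX H gH HG fgH].
  exact: self_similar_GGS.
have sumE := torsion_sum_exponent pr_p e_neq0 torG.
apply: (@conjugates_in_id p e).
exact: (conjugates_in_finitely_generated e_neq0 sumE indX gH HG fgH).
Qed.
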